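(* Let $E$ be a uniformizable abelian $t$-module over $K$ of dimension $d$ with $t$-motive $\mathcal{M}$ of rank $r$, $K[t]$-basis $\mathbf{m}=(m_1,\dots,m_r)^{\mathsf T}$, $\Theta\in\mathrm{Mat}_{r\times r}(K[t])$ with $\tau(\mathbf{m})=\Theta\mathbf{m}$, and $\Upsilon\in\mathrm{GL}_r(\mathbb{T})$ with $\tau(\Upsilon)=\Upsilon\Theta^{-1}$. Then there exist a matrix $B\in\mathrm{GL}_r(K[t])$ and a coordinate system of $E$ with corresponding isomorphism $E\cong\mathbb{G}_a^d$ such that, with $R:=\tau(\Upsilon)B^{-1}\in\mathrm{GL}_r(\mathbb{T})$, the coordinates (in the induced coordinates of $\mathrm{Lie}(E)$) of the elements of an $\mathbb{F}_q[t]$-basis of the period lattice $\Lambda$ are the values at $t=\theta$ of certain entries of the matrix $\rho_{[d-1]}(R^{-1})=\rho_{[d-1]}(R)^{-1}$.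
   Context: $K$ finite extension of $\mathbb{F}_q(\theta)$, $|\theta|=q$, $\mathbb{C}_\infty$ completion of an algebraic closure of $K_\infty$, $\mathbb{T}$ the Tate algebra of power series over $\mathbb{C}_\infty$ converging on $|t|\le1$. On series, $\tau(\sum x_it^i)=\sum x_i^qt^i$ (entrywise on matrices). Hyperderivatives: $\partial^{(n)}(\sum x_it^i)=\sum\binom{i}{n}x_it^{i-n}$; for a square matrix $M$, $\rho_{[n]}(M)$ is the $(n+1)\times(n+1)$ block upper triangular matrix with $(i,j)$ block $\partial^{(j-i)}(M)$ for $j\ge i$. A $t$-module $(E,\phi)$ of dimension $d$ over $K$: $E\cong\mathbb{G}_{a,K}^d$, $\phi:\mathbb{F}_q[t]\to\mathrm{End}_{\mathrm{grp},\mathbb{F}_q}(E)$ with $d\phi_t-\theta$ nilpotent on $\mathrm{Lie}(E)$; $\exp_E$ its exponential and $\Lambda=\ker\exp_E$ (an $\mathbb{F}_q[t]$-module via $d\phi$); uniformizable means $\exp_E$ is surjective on $\mathbb{C}_\infty$-points. The $t$-motive $\mathcal{M}=\mathrm{Hom}_{\mathrm{grp},\mathbb{F}_q}(E,\mathbb{G}_{a,K})$ is a $K[t]$-module via $(c\,a)\cdot m=c\cdot(m\circ\phi_a)$ with $\tau(m)=F\circ m$ ($F$ the $q$-Frobenius); abelian means $\mathcal{M}$ is finitely generated free over $K[t]$. The entries of $R^{-1}$ extend to entire functions of $t$ on $\mathbb{C}_\infty$, so their hyperderivatives can be evaluated at $t=\theta$. *)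

(* Defs.v *)
From HB Require Import structures.
From mathcomp Require Import all_boot all_order all_algebra all_field.
From mathcomp Require Import boolp classical_sets functions reals topology.
From mathcomp Require Import normedtype sequences.

Set Implicit Arguments.
Unset Strict Implicit.
Unset Printing Implicit Defensive.

Import Order.TTheory GRing.Theory Num.Theory numFieldNormedType.Exports.

Local Open Scope classical_set_scope.
Local Open Scope ring_scope.

(* The library's normed modules satisfy `|x *+ n| = `|x| *+ n, which fails in
   positive characteristic, hence a separate structure. *)
HB.mixin Record Field_isUltrametric (R : realType) C of GRing.Field C := {
  vabs : C -> R;
  vabs_ge0 : forall x, 0 <= vabs x;
  vabs_eq0 : forall x, (vabs x == 0) = (x == 0);
  vabsM : forall x y, vabs (x * y) = vabs x * vabs y;
  vabsD : forall x y, vabs (x + y) <= Num.max (vabs x) (vabs y)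
}.

#[short(type="ultraFieldType")]
HB.structure Definition UltraField (R : realType) :=
  {C of GRing.Field C & Field_isUltrametric R C}.

Section UltraFieldTheory.
Variables (R : realType) (C : ultraFieldType R).
Implicit Types (x y : C) (u v : nat -> C).

Definition vcvg u x := (fun n => vabs (u n - x)) @ \oo --> (0 : R).

Definition vcauchy u := forall e : R, 0 < e ->
  exists N, forall m n, (N <= m)%N -> (N <= n)%N -> vabs (u m - u n) < e.

Definition vcomplete := forall u, vcauchy u -> exists x, vcvg u x.

Definition vclosure (A : set C) : set C :=
  [set x | forall e : R, 0 < e -> exists2 y, A y & vabs (x - y) < e].

Lemma vabs0 : vabs (0 : C) = 0.
Proof. by apply/eqP; rewrite vabs_eq0. Qed.

Lemma vabs1 : vabs (1 : C) = 1.
Proof.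
have v1 : vabs (1 : C) != 0 by rewrite vabs_eq0 oner_eq0.
by apply: (mulfI v1); rewrite -vabsM !mulr1.
Qed.

Lemma vabsN x : vabs (- x) = vabs x.
Proof.
suff vN1 : vabs (-1 : C) = 1 by rewrite -mulN1r vabsM vN1 mul1r.
apply/eqP; rewrite -(@eqrXn2 _ 2) ?vabs_ge0 ?ler01 // expr1n.
by rewrite expr2 -vabsM mulrNN mulr1 vabs1.
Qed.

Lemma vabsX x n : vabs (x ^+ n) = vabs x ^+ n.
Proof. by elim: n => [|n IHn]; rewrite ?vabs1 // !exprS vabsM IHn. Qed.

Lemma vabs_natr_le1 n : vabs (n%:R : C) <= 1.
Proof.
elim: n => [|n IHn]; first by rewrite vabs0 ler01.
by rewrite -natr1 (le_trans (vabsD _ _)) // ge_max IHn vabs1 lexx.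
Qed.

Lemma vabs_sum_lt (I : Type) (s : seq I) (F : I -> C) (e : R) :
  0 < e -> (forall i, vabs (F i) < e) -> vabs (\sum_(i <- s) F i) < e.
Proof.
move=> e0 Fe; elim/big_rec: _ => [|i x _ xe]; first by rewrite vabs0.
by rewrite (le_lt_trans (vabsD _ _)) // gt_max Fe.
Qed.

Definition vnull u := (fun n => vabs (u n)) @ \oo --> (0 : R).

Lemma vnullP u : vnull u <->
  forall e : R, 0 < e -> exists N, forall n, (N <= n)%N -> vabs (u n) < e.
Proof.
split=> [/cvgr0Pnorm_lt u0 e e0 | u0].
  have [N _ uN] := u0 e e0; exists N => n Nn.
  by have := uN n Nn; rewrite /= ger0_norm ?vabs_ge0.
apply/cvgr0Pnorm_lt => e e0; have [N uN] := u0 e e0.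
by exists N => // n /= Nn; rewrite ger0_norm ?vabs_ge0 // uN.
Qed.

Lemma vnull_bounded u : vnull u -> exists2 M : R, 0 < M & forall n, vabs (u n) <= M.
Proof.
move=> /vnullP/(_ 1 ltr01)[N uN].
exists (1 + \sum_(i < N) vabs (u i)).
  by rewrite ltr_pwDl ?ltr01 // sumr_ge0 // => i _; rewrite vabs_ge0.
move=> n; have [Nn|nN] := leqP N n.
  rewrite (le_trans (ltW (uN n Nn))) // lerDl sumr_ge0 // => i _.
  exact: vabs_ge0.
rewrite (bigD1 (Ordinal nN)) //= addrCA lerDl addr_ge0 ?ler01 // sumr_ge0 // => i _.
exact: vabs_ge0.
Qed.

End UltraFieldTheory.

Definition fps (A : Type) : Type := nat -> A.

Section PowerSeries.
Variable A : comNzRingType.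
Implicit Types f g h : fps A.

HB.instance Definition _ := GRing.Zmodule.copy (fps A) (nat -> A).

Lemma fpsD f g n : (f + g) n = f n + g n. Proof. by []. Qed.

Definition fps_one : fps A := fun n => (n == 0)%:R.
Definition fps_mul f g : fps A := fun n => \sum_(i < n.+1) f i * g (n - i)%N.

Let trunc N f : {poly A} := \poly_(i < N) f i.

Let fps_mul_trunc N f g n : (n < N)%N ->
  fps_mul f g n = (trunc N f * trunc N g)`_n.
Proof.
move=> nN; rewrite coefM; apply: eq_bigr => i _.
by rewrite !coef_poly (leq_ltn_trans (leq_subr _ _) nN) (leq_trans (ltn_ord i) nN).
Qed.

Let coefM_eq (p p' r r' : {poly A}) n :
  (forall i, (i <= n)%N -> p`_i = p'`_i) ->
  (forall i, (i <= n)%N -> r`_i = r'`_i) -> (p * r)`_n = (p' * r')`_n.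
Proof.
move=> pp rr; rewrite !coefM; apply: eq_bigr => i _.
by rewrite pp ?rr // ?leq_subr // -ltnS.
Qed.

Let trunc_mul f g n i : (i <= n)%N ->
  (trunc n.+1 (fps_mul f g))`_i = (trunc n.+1 f * trunc n.+1 g)`_i.
Proof. by move=> lein; rewrite {1}/trunc coef_poly ltnS lein (@fps_mul_trunc n.+1). Qed.

Fact fps_mulA : associative fps_mul.
Proof.
move=> f g h; apply/funext => n; rewrite !(@fps_mul_trunc n.+1) //.
rewrite (@coefM_eq _ (trunc n.+1 f) _ (trunc n.+1 g * trunc n.+1 h)) //; last first.
  exact: trunc_mul.
rewrite mulrA; apply: esym; apply: coefM_eq => //; exact: trunc_mul.
Qed.

Fact fps_mulC : commutative fps_mul.
Proof. by move=> f g; apply/funext => n; rewrite !(@fps_mul_trunc n.+1) // mulrC. Qed.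

Fact fps_mul1 : left_id fps_one fps_mul.
Proof.
move=> f; apply/funext => n; rewrite /fps_mul big_ord_recl /= mul1r subn0.
by rewrite big1 ?addr0 // => i _; rewrite /fps_one mul0r.
Qed.

Fact fps_mulDl : left_distributive fps_mul +%R.
Proof.
move=> f g h; apply/funext => n; rewrite fpsD /fps_mul -big_split /=.
by apply: eq_bigr => i _; rewrite fpsD mulrDl.
Qed.

Fact fps_one_neq0 : fps_one != 0.
Proof. by apply/eqP => /(congr1 (fun f => f 0%N)) /eqP; rewrite oner_eq0. Qed.

HB.instance Definition _ := GRing.Zmodule_isComNzRing.Build (fps A)
  fps_mulA fps_mulC fps_mul1 fps_mulDl fps_one_neq0.

End PowerSeries.

Section TateAlgebra.
Variables (R : realType) (C : ultraFieldType R).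

Definition tate_pred : {pred fps C} := fun f => `[< vnull f >].

Fact tate_subring_closed : subring_closed tate_pred.
Proof.
split=> [|f g|f g]; rewrite ?unfold_in.
- apply/asboolP/vnullP => e e0; exists 1%N => -[//|n] _.
  by rewrite [X in vabs X](_ : _ = 0) ?vabs0.
- move=> /asboolP/vnullP f0 /asboolP/vnullP g0; apply/asboolP/vnullP => e e0.
  have [N fN] := f0 e e0; have [M gM] := g0 e e0.
  exists (maxn N M) => n; rewrite geq_max => /andP[Nn Mn].
  by rewrite (le_lt_trans (vabsD _ _)) // vabsN gt_max fN ?gM.
- move=> /asboolP f0 /asboolP g0; apply/asboolP/vnullP => e e0.
  have [F F0 fF] := vnull_bounded f0; have [G G0 gG] := vnull_bounded g0.
  have [N fN] := (vnullP f).1 f0 (e / G) (divr_gt0 e0 G0).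
  have [M gM] := (vnullP g).1 g0 (e / F) (divr_gt0 e0 F0).
  exists (N + M)%N => n NMn; apply: vabs_sum_lt => // i; rewrite vabsM.
  have [Ni|iN] := leqP N i.
    rewrite (le_lt_trans (ler_wpM2l (vabs_ge0 _) (gG _))) //.
    by rewrite -ltr_pdivlMr // fN.
  rewrite (le_lt_trans (ler_wpM2r (vabs_ge0 _) (fF _))) //.
  rewrite mulrC -ltr_pdivlMr // gM // leq_subRL; last by rewrite -ltnS.
  by rewrite (leq_trans _ NMn) // leq_add2r ltnW.
Qed.

HB.instance Definition _ :=
  GRing.isSubringClosed.Build (fps C) tate_pred tate_subring_closed.

Record tate : Type := Tate {tateval : fps C; tatevalP : tateval \in tate_pred}.

HB.instance Definition _ := [isSub for tateval].
HB.instance Definition _ := [Choice of tate by <:].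
HB.instance Definition _ := [SubChoice_isSubComNzRing of tate by <:].

Lemma tatevalM (f g : tate) n :
  tateval (f * g) n = \sum_(i < n.+1) tateval f i * tateval g (n - i)%N.
Proof. by []. Qed.

Definition tate_unit : {pred tate} := fun f => `[< exists g, g * f = 1 >].
Definition tate_inv (f : tate) : tate :=
  if pselect (exists g, g * f = 1) is left ex then sval (cid ex) else f.

Fact tate_mulVf : {in tate_unit, left_inverse 1 tate_inv *%R}.
Proof.
move=> f; rewrite unfold_in => /asboolP uf; rewrite /tate_inv.
by case: pselect => // ex; case: (cid ex).
Qed.

Fact tate_unitP (f g : tate) : g * f = 1 -> tate_unit f.
Proof. by move=> gf; apply/asboolP; exists g. Qed.

Fact tate_inv_out : {in [predC tate_unit], tate_inv =1 id}.
Proof.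
move=> f; rewrite inE /= unfold_in => /asboolPn nuf.
by rewrite /tate_inv; case: pselect.
Qed.

HB.instance Definition _ := GRing.ComNzRing_hasMulInverse.Build tate
  tate_mulVf tate_unitP tate_inv_out.

Fact tate_poly_subproof (p : {poly C}) : (fun i => p`_i) \in tate_pred.
Proof.
rewrite unfold_in; apply/asboolP/vnullP => e e0.
by exists (size p) => n /leq_sizeP/(_ n (leqnn n)) ->; rewrite vabs0.
Qed.
Definition tate_poly (p : {poly C}) := Tate (tate_poly_subproof p).

Fact tate_frob_subproof (Fq : finFieldType) (f : tate) :
  (fun i => tateval f i ^+ #|Fq|) \in tate_pred.
Proof.
rewrite -(ltn_predK (finNzRing_gt1 Fq)); move: #|Fq|.-1 => q.
rewrite unfold_in; apply/asboolP/vnullP => e e0.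
have /asboolP/vnullP f0 := tatevalP f.
have [|N fN] := f0 (Num.min 1 e); first by rewrite lt_min ltr01.
exists N => n Nn; have := fN n Nn; rewrite lt_min => /andP[f1 fe].
rewrite vabsX (le_lt_trans _ fe) // exprS ler_piMr ?vabs_ge0 //.
by rewrite exprn_ile1 ?vabs_ge0 // ltW.
Qed.

Definition tate_tau Fq (f : tate) : tate := Tate (tate_frob_subproof Fq f).

Fact tate_hyper_subproof n (f : tate) :
  (fun i => tateval f (i + n)%N *+ 'C(i + n, n)) \in tate_pred.
Proof.
rewrite unfold_in; apply/asboolP/vnullP => e e0.
have /asboolP/vnullP/(_ e e0)[N fN] := tatevalP f.
exists N => i Ni; rewrite -mulr_natr vabsM.
rewrite (le_lt_trans (ler_wpM2l (vabs_ge0 _) (vabs_natr_le1 _ _))) // mulr1.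
by rewrite fN // (leq_trans Ni) // leq_addr.
Qed.
Definition hyperderiv n (f : tate) : tate := Tate (tate_hyper_subproof n f).

Definition rho n r (M : 'M[tate]_r) : 'M[tate]_(\sum_(i < n.+1) r) :=
  \mxblock_(i < n.+1, j < n.+1)
    (if (i <= j)%N then map_mx (hyperderiv (j - i)) M else 0).

Definition tate_value (f : tate) (z v : C) :=
  vcvg (fun n => \sum_(i < n) tateval f i * z ^+ i) v.

End TateAlgebra.

(* The ring K{tau} of polynomials \sum_i a_i tau^i, with tau a = a^q tau,
   is the ring of F_q-linear endomorphisms of the additive group over K.
   It is carried by {poly K}: the i-th coefficient of the polynomial is a_i. *)
Section TwistedPolynomials.
Variables (Fq : finFieldType) (K : fieldExtType {fraction {poly Fq}}).
Local Notation q := #|Fq|.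

Definition theta : K := (tofrac 'X)%:A.

Definition twpoly : Type := {poly K}.

HB.instance Definition _ := GRing.Zmodule.copy twpoly {poly K}.

Definition twcoef (f : twpoly) i : K := (f : {poly K})`_i.
Definition twsize (f : twpoly) : nat := size (f : {poly K}).
Definition twconst (c : K) : twpoly := c%:P.
Definition twtau : twpoly := 'X.

Definition twmul (f g : twpoly) : twpoly :=
  \poly_(n < twsize f + twsize g)
    \sum_(i < n.+1) twcoef f i * twcoef g (n - i) ^+ (q ^ i).

Let qpow_gt0 i : (0 < q ^ i)%N.
Proof. by rewrite expn_gt0 (ltnW (finNzRing_gt1 Fq)). Qed.

Let expq0 i : (0 : K) ^+ (q ^ i) = 0.
Proof. by rewrite expr0n (gtn_eqF (qpow_gt0 i)). Qed.

Let expqD i (x y : K) : (x + y) ^+ (q ^ i) = x ^+ (q ^ i) + y ^+ (q ^ i).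
Proof.
have [p p_pr pF] := finPcharP Fq.
have pK : p \in [pchar K].
  rewrite inE p_pr /= -(rmorph_nat (in_alg K)) -(rmorph_nat (@tofrac {poly Fq})).
  by rewrite -(rmorph_nat (@polyC Fq)) (pcharf0 pF) !rmorph0.
have qp : p.-nat q.
  by rewrite (card_pprimeChar pF) pnatX pnat_id.
by apply: exprDn_pchar; rewrite (eq_pnat _ (pcharf_eq pK)) pnatX qp.
Qed.

Lemma twcoefM f g n :
  twcoef (twmul f g) n = \sum_(i < n.+1) twcoef f i * twcoef g (n - i) ^+ (q ^ i).
Proof.
rewrite {1}/twcoef coef_poly; case: ltnP => // len.
rewrite big1 // => i _; have [lei|gti] := leqP (twsize f) i.
  by rewrite [twcoef f i]nth_default ?mul0r.
rewrite [X in _ * X ^+ _](_ : _ = 0) ?expq0 ?mulr0 //.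
apply: nth_default; rewrite leq_subRL; last by rewrite -ltnS.
by rewrite (leq_trans _ len) // leq_add2r ltnW.
Qed.

Let twP (f g : twpoly) : (forall n, twcoef f n = twcoef g n) -> f = g.
Proof. by move=> fg; apply/polyP. Qed.

Let twcoefD (f g : twpoly) n : twcoef (f + g) n = twcoef f n + twcoef g n.
Proof. exact: coefD. Qed.

Let expq_sum i (I : Type) (s : seq I) (F : I -> K) :
  (\sum_(k <- s) F k) ^+ (q ^ i) = \sum_(k <- s) F k ^+ (q ^ i).
Proof. exact: (big_morph (fun x => x ^+ (q ^ i)) (expqD i) (expq0 i)). Qed.

Fact twmulA : associative twmul.
Proof.
move=> f g h; apply: twP => n; rewrite !twcoefM.
pose c3 i j := twcoef f i * (twcoef g j * twcoef h (n - i - j) ^+ (q ^ j)) ^+ (q ^ i).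
transitivity (\sum_(i < n.+1) \sum_(j < (n - i).+1) c3 i j).
  by apply: eq_bigr => i _; rewrite twcoefM expq_sum big_distrr.
transitivity (\sum_(k < n.+1) \sum_(i < k.+1) c3 i (k - i)%N); last first.
  apply: eq_bigr => k _; rewrite twcoefM big_distrl /=; apply: eq_bigr => i _.
  have lik : (i <= k)%N by rewrite -ltnS.
  by rewrite /c3 exprMn -exprM -expnD subnK // -subnDA subnKC // mulrA.
have nat_sum N (F : nat -> nat -> K) :
  \sum_(i < N) \sum_(j < N - i) F i j = \sum_(k < N) \sum_(i < k.+1) F i (k - i)%N.
  elim: N => [|N IHN]; first by rewrite !big_ord0.
  rewrite [RHS]big_ord_recr /= -IHN [LHS]big_ord_recr /= subSnn big_ord1.
  rewrite [X in _ = _ + X]big_ord_recr /= subnn addrA; congr (_ + _).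
  rewrite -big_split /=; apply: eq_bigr => i _.
  by rewrite subSn ?big_ord_recr //= ltnW.
by rewrite -nat_sum; apply: eq_bigr => i _; rewrite subSn // -ltnS.
Qed.

Fact twmul1l : left_id (twconst 1) twmul.
Proof.
move=> f; apply: twP => n; rewrite twcoefM big_ord_recl /= subn0 /twcoef /twconst.
rewrite coefC mul1r expr1 big1 ?addr0 // => i _.
by rewrite coefC mul0r.
Qed.

Fact twmul1r : right_id (twconst 1) twmul.
Proof.
move=> f; apply: twP => n; rewrite twcoefM big_ord_recr /= subnn /twcoef /twconst.
rewrite coefC expr1n mulr1 big1 ?add0r // => i _.
by rewrite coefC subn_eq0 leqNgt ltn_ord expq0 mulr0.
Qed.

Fact twmulDl : left_distributive twmul +%R.
Proof.
move=> f g h; apply: twP => n; rewrite twcoefD !twcoefM -big_split /=.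
by apply: eq_bigr => i _; rewrite twcoefD mulrDl.
Qed.

Fact twmulDr : right_distributive twmul +%R.
Proof.
move=> f g h; apply: twP => n; rewrite twcoefD !twcoefM -big_split /=.
by apply: eq_bigr => i _; rewrite twcoefD expqD mulrDr.
Qed.

Fact twone_neq0 : twconst 1 != 0.
Proof. exact: (oner_neq0 {poly K}). Qed.

HB.instance Definition _ := GRing.Zmodule_isNzRing.Build twpoly
  twmulA twmul1l twmul1r twmulDl twmulDr twone_neq0.

End TwistedPolynomials.

(* b is an A-basis of the A-submodule S of V; act is the action of A on V. *)
Definition module_basis (A : nzRingType) (V : zmodType) (act : A -> V -> V)
    (S : set V) n (b : 'I_n -> V) : Prop :=
  (forall i, S (b i)) /\
  (forall x, S x -> exists! c : 'rV[A]_n, x = \sum_i act (c 0 i) (b i)).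

(* The differential at the origin of an F_q-linear homomorphism. *)
Definition twdiff (Fq : finFieldType) (K : fieldExtType {fraction {poly Fq}})
    m n (F : 'M[twpoly K]_(m, n)) : 'M[K]_(m, n) :=
  map_mx ((@twcoef _ K)^~ 0%N) F.

(* The group scheme E is identified with G_a^d by a reference coordinate
   system, so that F_q-linear homomorphisms G_a^n -> G_a^m are m x n matrices
   over K{tau}.  Any other coordinate system E -> G_a^d is then given by a
   matrix in GL_d(K{tau}), see coordinate_system. *)
Record tmodule (Fq : finFieldType) (K : fieldExtType {fraction {poly Fq}})
    (d : nat) := TModule {
  tm_phi :> {rmorphism {poly Fq} -> 'M[twpoly K]_d};
  tm_phi_const : forall c : Fq,
    tm_phi c%:P = (twconst ((tofrac c%:P)%:A : K))%:M;
  tm_phi_nilp : exists n,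
    (twdiff (tm_phi 'X) - (theta K)%:M) ^+ n = 0
}.

Section TModules.
Variables (Fq : finFieldType) (K : fieldExtType {fraction {poly Fq}}).
Local Notation q := #|Fq|.

Definition coordinate_system d (U : 'M[twpoly K]_d) : Prop :=
  exists V, V *m U = 1%:M /\ U *m V = 1%:M.

(* Elements of the t-motive Hom(E, G_a) are row vectors over K{tau}. *)
Definition motive_act d (E : tmodule K d) (p : {poly K}) (m : 'rV[twpoly K]_d) :
    'rV[twpoly K]_d :=
  \sum_(i < size p) twconst p`_i *: (m *m E 'X^i).

Definition motive_tau d (m : 'rV[twpoly K]_d) : 'rV[twpoly K]_d := twtau K *: m.

Definition motive_basis d (E : tmodule K d) r (m : 'I_r -> 'rV[twpoly K]_d) :=
  module_basis (motive_act E) setT m.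

Definition abelian_tmodule d (E : tmodule K d) : Prop :=
  exists r (m : 'I_r -> 'rV[twpoly K]_d), motive_basis E m.

Section Points.
Variables (R : realType) (C : ultraFieldType R) (iota : {rmorphism K -> C}).

(* C is the completion of an algebraic closure of Kinf, where Kinf is the
   completion of K for the absolute value induced by iota, normalized by
   |theta| = q.  Inside the complete field C, the completion of a subset is
   its closure. *)
Definition Kinf : set C := vclosure (range iota).

Definition Kinf_algebraic : set C :=
  [set x | exists2 p : {poly C}, p != 0 & (forall i, Kinf p`_i) /\ root p x].

Definition is_Cinf : Prop :=
  [/\ vabs (iota (theta K)) = q%:R,
      vcomplete C,
      forall p : {poly C}, (forall i, Kinf_algebraic p`_i) -> (1 < size p)%N ->
        exists2 x, Kinf_algebraic x & root p x
    & vclosure Kinf_algebraic = setT].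

Definition tw_eval (f : twpoly K) (x : C) : C :=
  \sum_(i < twsize f) iota (twcoef f i) * x ^+ (q ^ i).

Definition tw_act m n (F : 'M[twpoly K]_(m, n)) (x : 'cV[C]_n) : 'cV[C]_m :=
  \col_i \sum_j tw_eval (F i j) (x j 0).

Definition lie_act d (E : tmodule K d) (a : {poly Fq}) (z : 'cV[C]_d) : 'cV[C]_d :=
  map_mx iota (twdiff (E a)) *m z.

Definition is_exponential d (E : tmodule K d) (expE : 'cV[C]_d -> 'cV[C]_d) :=
  (exists Q : nat -> 'M[C]_d, Q 0%N = 1%:M /\
    forall z i, vcvg
      (fun N => (\sum_(n < N) Q n *m map_mx (fun x => x ^+ (q ^ n)) z) i 0)
      (expE z i 0)) /\
  (forall a z, expE (lie_act E a z) = tw_act (E a) (expE z)).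

Definition uniformizable d (expE : 'cV[C]_d -> 'cV[C]_d) : Prop :=
  forall y, exists z, expE z = y.

Definition period_lattice d (expE : 'cV[C]_d -> 'cV[C]_d) : set 'cV[C]_d :=
  [set z | expE z = 0].

Definition poly_tate (p : {poly K}) : tate C := tate_poly (map_poly iota p).

End Points.
End TModules.

(* Main.v *)
Require Import Defs.
From HB Require Import structures.
From mathcomp Require Import all_boot all_order all_fingroup all_algebra all_field.
From mathcomp Require Import boolp classical_sets functions reals topology.
From mathcomp Require Import normedtype sequences zify ring lra.

Set Implicit Arguments.
Unset Strict Implicit.
Unset Printing Implicit Defensive.

Import Order.TTheory GRing.Theory Num.Theory.
Local Open Scope ring_scope.

(* Anderson generating functions turn a period lambda into a point
   e = \sum_n exp(N^(-n-1) lambda) t^n of E over the Tate algebra with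
   phi_t(e) = t e, where N = d phi_t.  Evaluating the basis of the motive at e gives a
   solution x of tau(x) = Theta x, so that Upsilon x lies in F_q[t]^r; since exp is
   locally invertible, this identifies the period lattice with F_q[t]^r.

   Write Theta = A D P with A, P invertible over K[t] and D diagonal.  The motive modulo the
   K[t]-span of its Frobenius image is dual to Lie(E), where t - theta is nilpotent, so
   D = diag((t - theta)^(k_i)) with k_i <= d.  With B = A^-1, the equation for x reads
   (t - theta)^(k_i) (P x)_i = (R^-1 Upsilon x)_i.  On the other hand (P x)_i is, up to a
   series converging beyond theta, mu_i (N - t)^-1 lambda, where mu_i is the linear
   form on Lie(E) given by the i-th row of P; hence hyperderivatives of R^-1 at theta are
   the values at lambda of the forms mu_i (N - theta)^j with j < k_i.  These forms span
   the dual of Lie(E), hence contain a coordinate system. *)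

(** * Diagonalization of polynomial matrices *)

(** The obstacle is evaluation at theta: |theta| > 1, whereas elements of the Tate algebra converge
    only on the closed unit disc. The entry (P x)_i is therefore split into sum_n mu_i N^(-n-1)
    lambda t^n and a remainder with coefficients O(|theta|^(-2n)). Since N - t = S - (t - theta)
    with S = N - theta nilpotent, the first part is the rational function - sum_a mu_i S^a lambda /
    (t - theta)^(a+1). Multiplying by (t - theta)^(k_i) makes it a polynomial in t - theta and
    pushes the remainder to orders >= k_i, so the hyperderivative of order k_i - a - 1 at theta
    isolates - mu_i S^a lambda. The basis of periods is normalized by Upsilon x = - e_j to absorb
    this sign. The bound k_i <= d keeps all orders within rho_[d-1]. *)

Section Diagonalization.
Variable F : fieldType.

(** Euclidean division by the pivot, by induction on its size: a nonzero remainder in the first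
    column or row is a smaller pivot, and if there is none both are cleared. The divisibility chain
    of the Smith form is not sought; the diagonal entries are identified later from the nilpotency
    of t - theta on Lie(E). *)
Lemma poly_pivot_block n (M : 'M[{poly F}]_(1 + n)) i j : M i j != 0 ->
  exists L P (a : {poly F}) (M' : 'M_n), [/\ L \in unitmx, P \in unitmx &
    L *m M *m P = block_mx a%:M 0 0 M'].
Proof.
have [s] := ubnP (size (M i j)); elim: s => // s IHs in M i j *.
rewrite ltnS => les Mij.
wlog [i0 j0]: M i j les Mij / i = 0 /\ j = 0.
  move=> H; pose M0 : 'M_(1 + n) := xrow i 0 (xcol j 0 M).
  have M00 : M0 0 0 = M i j by rewrite !mxE !tpermR.
  have [||//|L [P [a [M' [uL uP E]]]]] := H M0 0 0; rewrite ?M00 //.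
  exists (L *m tperm_mx i 0), (tperm_mx j 0 *m P), a, M'; split.
  - by rewrite unitmx_mul uL unitmx_perm.
  - by rewrite unitmx_mul uP unitmx_perm.
  - by rewrite -E /M0 xrowE xcolE !mulmxA.
subst i j; set a := M 0 0 in les Mij.
pose u := ursubmx M; pose v := dlsubmx M; pose w := drsubmx M.
have EM : M = block_mx a%:M u v w.
  by rewrite -[LHS]submxK [ulsubmx M]mx11_scalar !mxE lshift0.
(* Quotients [x], [y] and remainders [c], [b] of the first column and the first row by the pivot. *)
pose x := map_mx (fun p => p %/ a) v; pose c := map_mx (fun p => p %% a) v.
pose y := map_mx (fun p => p %/ a) u; pose b := map_mx (fun p => p %% a) u.
have Ev : v - x *m a%:M = c.
  apply/matrixP=> i j; rewrite !mxE big_ord1 !mxE (ord1 j) eqxx mulr1n.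
  by rewrite {1}(divp_eq (M (rshift 1 i) (lshift n 0)) a) addrC addKr.
have Eu : u - a%:M *m y = b.
  rewrite mul_scalar_mx; apply/matrixP=> i j; rewrite !mxE.
  by rewrite {1}(divp_eq (M (lshift n i) (rshift 1 j)) a) mulrC addrC addKr.
pose L : 'M_(1 + n) := block_mx 1%:M 0 (- x) 1%:M.
have uL : L \in unitmx by rewrite unitmxE det_lblock !det1 mulr1 unitr1.
pose M1 := L *m M; pose w1 := - x *m u + w.
have E1 : M1 = block_mx a%:M u c w1.
  rewrite /M1 EM mulmx_block !mul1mx !mul0mx !addr0.
  by congr block_mx; rewrite mulNmx addrC.
have [/existsP[i ci]|] := boolP [exists i, c i 0 != 0]; last first.
  rewrite negb_exists => /forallP c0.
  pose P : 'M_(1 + n) := block_mx 1%:M (- y) 0 1%:M.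
  have uP : P \in unitmx by rewrite unitmxE det_ublock !det1 mulr1 unitr1.
  have c00 : c = 0.
    by apply/matrixP => i j; rewrite (ord1 j) [RHS]mxE; have := c0 i; rewrite negbK => /eqP.
  have E2 : M1 *m P = block_mx a%:M b 0 w1.
    rewrite E1 c00 mulmx_block !mulmx0 !mulmx1 !mul0mx !addr0 add0r; congr block_mx.
    by rewrite mulmxN addrC.
  have [/existsP[j bj]|] := boolP [exists j, b 0 j != 0]; last first.
    rewrite negb_exists => /forallP b0.
    exists L, P, a, w1; split=> //; rewrite -/M1 E2; congr block_mx.
    by apply/matrixP => i j; rewrite (ord1 i) [RHS]mxE; have := b0 j; rewrite negbK => /eqP.
  have bE : (M1 *m P) (lshift n 0) (rshift 1 j) = b 0 j by rewrite E2 block_mxEur.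
  have [||L' [P' [a' [M' [uL' uP' E]]]]] := IHs (M1 *m P) (lshift n 0) (rshift 1 j).
  - by rewrite bE mxE (leq_trans _ les) // ltn_modpN0.
  - by rewrite bE.
  exists (L' *m L), (P *m P'), a', M'; split; rewrite ?unitmx_mul ?uL ?uP ?uL' ?uP' //.
  by rewrite -E /M1 !mulmxA.
have cE : M1 (rshift 1 i) (lshift n 0) = c i 0 by rewrite E1 block_mxEdl.
have [||L' [P' [a' [M' [uL' uP' E]]]]] := IHs M1 (rshift 1 i) (lshift n 0).
- by rewrite cE mxE (leq_trans _ les) // ltn_modpN0.
- by rewrite cE.
exists (L' *m L), P', a', M'; split; rewrite ?unitmx_mul ?uL ?uL' //.
by rewrite -E /M1 !mulmxA.
Qed.

Lemma poly_diagonalization n (M : 'M[{poly F}]_n) :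
  exists L (D : 'rV_n) P, [/\ L \in unitmx, P \in unitmx & M = L *m diag_mx D *m P].
Proof.
suff [L [D [P [uL uP E]]]] : exists L (D : 'rV_n) P,
    [/\ L \in unitmx, P \in unitmx & L *m M *m P = diag_mx D].
  exists (invmx L), D, (invmx P); rewrite !unitmx_inv; split=> //.
  by rewrite -E !mulmxA mulVmx // mul1mx mulmxK.
elim: n M => [|n IHn] M.
  by exists 1%:M, 0, 1%:M; rewrite unitmx1; split=> //; apply/matrixP => -[].
have [/existsP[i /existsP[j Mij]]|M0] :=
    boolP [exists i, exists j, M i j != 0]; last first.
  exists 1%:M, 0, 1%:M; rewrite unitmx1 mul1mx mulmx1 raddf0; split=> //.
  apply/matrixP => i j; rewrite [RHS]mxE; apply/eqP.
  move: M0; rewrite negb_exists => /forallP/(_ i).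
  by rewrite negb_exists => /forallP/(_ j); rewrite negbK.
have [L [P [a [M' [uL uP E]]]]] := poly_pivot_block Mij.
have [L' [D [P' [uL' uP' E']]]] := IHn M'.
have uB (A : 'M[{poly F}]_n) : A \in unitmx ->
    (block_mx 1%:M 0 0 A : 'M_(1 + n)) \in unitmx.
  by rewrite !unitmxE det_ublock det1 mul1r.
have EB : (block_mx 1%:M 0 0 L' : 'M_(1 + n)) *m block_mx a%:M 0 0 M' *m
    (block_mx 1%:M 0 0 P' : 'M_(1 + n)) = diag_mx (row_mx a%:M D).
  rewrite !mulmx_block !(mulmx0, mul0mx, mulmx1, mul1mx, addr0, add0r) E' diag_mx_row.
  by congr block_mx; rewrite [RHS]mx11_scalar !mxE eqxx mulr1n.
exists (block_mx 1%:M 0 0 L' *m L : 'M_(1 + n)), (row_mx a%:M D).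
exists (P *m block_mx 1%:M 0 0 P' : 'M_(1 + n)).
split; rewrite ?unitmx_mul ?uL ?uP ?uB //.
by rewrite -EB -E !mulmxA.
Qed.

End Diagonalization.

(** The minimal polynomial divides X^n, so it is X^k up to a unit, and k <= d by Cayley-Hamilton.
    This bound is the origin of the index d - 1 in the theorem. *)
Lemma nilpotent_mx_exp (F : fieldType) d n (S : 'M[F]_d) : S ^+ n = 0 -> S ^+ d = 0.
Proof.
case: d S => [|d] S Sn; first by apply/matrixP => -[].
have XnS k : horner_mx S ('X^k) = S ^+ k by rewrite rmorphXn /= horner_mx_X.
have : mxminpoly S %| ('X - 0%:P) ^+ n by apply: mxminpoly_min; rewrite subr0 XnS.
case/dvdp_exp_XsubCP => k _; rewrite subr0 => eqX.
have kd : (k <= d.+1)%N.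
  have := dvdp_leq (monic_neq0 (char_poly_monic S)) (mxminpoly_dvd_char S).
  by rewrite (eqp_size eqX) size_polyXn size_char_poly.
suff Sk : S ^+ k = 0 by have := exprD S (d.+1 - k) k; rewrite subnK // Sk mulr0.
by rewrite -XnS; apply/mxminpoly_minP; rewrite (eqp_dvdl _ eqX).
Qed.

Lemma unitmx_map (S T : comUnitRingType) (f : {rmorphism S -> T}) n (A : 'M[S]_n) :
  A \in unitmx -> map_mx f A \in unitmx.
Proof.
move=> uA; have : map_mx f A *m map_mx f (invmx A) = 1%:M.
  by rewrite -map_mxM mulmxV // map_mx1.
by case/mulmx1_unit.
Qed.

Lemma unitmx_mulP (S : comUnitRingType) n (A B : 'M[S]_n) :
  A \in unitmx -> B \in unitmx -> A *m B \in unitmx.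
Proof. by rewrite unitmx_mul => -> ->. Qed.

(** In the application [A] is the left factor of Theta and [B] is tau(Upsilon), so that [B *m A] is
    the matrix R. *)
Lemma mulmx_solve (S : comUnitRingType) n p (A B D : 'M[S]_n) (x y : 'M_(n, p)) :
  A \in unitmx -> B \in unitmx -> A *m D *m x = invmx B *m y ->
  D *m x = invmx (B *m A) *m y.
Proof.
move=> uA uB Dx; have uBA : B *m A \in unitmx by rewrite unitmx_mul uB.
by rewrite -[LHS](mulKmx uBA) -!mulmxA [A *m _]mulmxA Dx mulKVmx.
Qed.

Lemma unitmx_rowsub (F : fieldType) n d (G : 'M[F]_(n, d)) :
  row_full G -> exists f : 'I_d -> 'I_n, rowsub f G \in unitmx.
Proof.
move=> fG; exists (fullrankfun fG).
exact: fullrowsub_unit.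
Qed.

(** * Hyperderivatives *)

Section Tate.
Variables (R : realType) (C : ultraFieldType R).
Implicit Types f g : tate C.

Lemma tateP f g : (forall n, tateval f n = tateval g n) -> f = g.
Proof. by move=> fg; apply: val_inj; apply/funext. Qed.

Lemma tateval0 n : tateval (0 : tate C) n = 0. Proof. by []. Qed.

Lemma tateval1 n : tateval (1 : tate C) n = (n == 0)%:R. Proof. by []. Qed.

Lemma tatevalD f g n : tateval (f + g) n = tateval f n + tateval g n.
Proof. by []. Qed.

Lemma tatevalN f n : tateval (- f) n = - tateval f n.
Proof. by []. Qed.

Lemma tateval_sum I (s : seq I) (P : pred I) (F : I -> tate C) n :
  tateval (\sum_(i <- s | P i) F i) n = \sum_(i <- s | P i) tateval (F i) n.
Proof. exact: (big_morph (fun f => tateval f n)). Qed.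

Lemma hyperderivE n f k :
  tateval (hyperderiv n f) k = tateval f (k + n)%N *+ 'C(k + n, n).
Proof. by []. Qed.

(** Vandermonde's identity distributes the binomial 'C(k + n, n) over the two factors of each
    product of coefficients. *)
Lemma hyperderivM n f g :
  hyperderiv n (f * g) = \sum_(i < n.+1) hyperderiv i f * hyperderiv (n - i) g.
Proof.
apply: tateP => k; rewrite tateval_sum hyperderivE tatevalM.
pose G i A : C :=
  tateval f A * tateval g (k + n - A)%N *+ ('C(A, i) * 'C(k + n - A, n - i)).
transitivity (\sum_(i < n.+1) \sum_(A < (k + n).+1) G i A).
  rewrite exchange_big -sumrMnl; apply: eq_bigr => A _ /=.
  by rewrite sumrMnr binomial.Vandermonde subnKC // -ltnS.
apply: eq_bigr => i _; rewrite tatevalM.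
have lein : (i <= n)%N by rewrite -ltnS.
(* One of the two binomials vanishes unless i <= A <= k + i; the remaining terms are reindexed by A
   = a + i. *)
rewrite -(big_mkord xpredT (G i)) (big_cat_nat (n := i)) ?leqW ?(leq_trans lein) ?leq_addl //=.
rewrite big_nat big1 ?add0r => [|A /andP[_ Ai]]; last first.
  by rewrite /G bin_small // mul0n mulr0n.
rewrite (big_cat_nat (n := (k + i).+1)) /= ?ltnS ?leq_add2l // ?leqW ?leq_addl //.
rewrite [X in _ + X]big_nat [X in _ + X]big1 ?addr0 => [|A /andP[kA An]]; last first.
  rewrite /G [X in (_ * X)%N]bin_small ?muln0 ?mulr0n //.
  by lia.
rewrite -{1}(add0n i) big_addn subSn ?leq_addl // addnK big_mkord.
apply: eq_bigr => a _; rewrite /G.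
have -> : (k + n - (a + i) = k - a + (n - i))%N.
  by have := ltn_ord a; lia.
by rewrite mulrnAl mulrnAr -mulrnA mulnC.
Qed.

Lemma hyperderiv_1 n : hyperderiv n (1 : tate C) = (n == 0)%:R.
Proof.
apply: tateP => k; rewrite hyperderivE tateval1 addn_eq0.
case: n => [|n]; first by rewrite andbT addn0 bin0 mulr1n tateval1.
by rewrite andbF mul0rn tateval0.
Qed.

Lemma hyperderiv0 n : hyperderiv n (0 : tate C) = 0.
Proof. by apply: tateP => k; rewrite hyperderivE mul0rn. Qed.

Lemma hyperderivD n f g : hyperderiv n (f + g) = hyperderiv n f + hyperderiv n g.
Proof. by apply: tateP => k; rewrite tatevalD !hyperderivE mulrnDl. Qed.

Lemma hyperderiv_sum n I (s : seq I) (F : I -> tate C) :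
  hyperderiv n (\sum_(i <- s) F i) = \sum_(i <- s) hyperderiv n (F i).
Proof. exact: (big_morph _ (hyperderivD n) (hyperderiv0 n)). Qed.

(** In block (i, k) only the indices i <= j <= k contribute, and their sum is the Leibniz rule of
    order k - i. Being multiplicative and unital, [rho n] commutes with inversion. *)
Lemma rho_mul n r (M N : 'M[tate C]_r) : rho n M *m rho n N = rho n (M *m N).
Proof.
rewrite mul_mxblock; apply: eq_mxblock => i k.
have [leik|ltki] := leqP i k; last first.
  apply: big1 => j _; have [leij|_] := leqP i j; last by rewrite mul0mx.
  by rewrite leqNgt (leq_trans ltki leij) mulmx0.
rewrite (bigID (fun j : 'I_n.+1 => (i <= j <= k)%N)) /= [X in _ + X]big1 ?addr0; last first.
  move=> j; rewrite negb_and => /orP[]/negPf->; first by rewrite mul0mx.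
  by rewrite mulmx0.
apply/matrixP => a b; rewrite summxE !mxE hyperderiv_sum.
transitivity (\sum_(j < n.+1 | (i <= j <= k)%N) \sum_l
    hyperderiv (j - i) (M a l) * hyperderiv (k - j) (N l b)).
  by apply: eq_bigr => j /andP[-> ->]; rewrite mxE; apply: eq_bigr => l _; rewrite !mxE.
rewrite exchange_big /=; apply: eq_bigr => l _; rewrite hyperderivM.
pose H j := hyperderiv (j - i) (M a l) * hyperderiv (k - j) (N l b).
rewrite -(big_mkord (fun j => (i <= j <= k)%N) H) big_mkcond /=.
rewrite (big_cat_nat (n := i)) //=; last by rewrite ltnW.
rewrite big_nat big1 ?add0r => [|j /andP[_ ji]]; last by rewrite leqNgt ji.
rewrite (big_cat_nat (n := k.+1)) //= ?leqW //.
rewrite [X in _ + X]big_nat [X in _ + X]big1 ?addr0 => [|j /andP[kj _]]; last first.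
  by rewrite [(j <= k)%N]leqNgt kj andbF.
rewrite -{1}(add0n i) big_addn subSn // big_mkord; apply: eq_bigr => j _.
have jik : (j + i <= k)%N by have := ltn_ord j; lia.
by rewrite leq_addl jik /H addnK subnDA subnAC.
Qed.

Lemma rho_1 n r : rho n (1%:M : 'M[tate C]_r) = 1%:M.
Proof.
apply/matrixP => s t; rewrite !mxE.
(* Flat indices are decoded into pairs (block, position), so that the identity can be compared block
   by block. *)
rewrite -(can_eq tagnat.sigK) -tag_eqE /tag_eq /tagnat.sig1 /tagnat.sig2.
case: (tagnat.sig s) (tagnat.sig t) => [i a] [j b] /=.
have [eij|neij] := eqVneq i j.
  case: j / eij b => b; rewrite tagged_asE leqnn !mxE subnn.
  by case: (a == b); rewrite ?hyperderiv_1 ?hyperderiv0.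
have [leij|_] := leqP i j; last by rewrite mxE.
rewrite !mxE; case: (a == b); rewrite ?hyperderiv0 // hyperderiv_1.
by rewrite subn_eq0 leqNgt ltn_neqAle leij neij.
Qed.


Lemma rho_unit n r (M : 'M[tate C]_r) : M \in unitmx ->
  rho n M \in unitmx /\ rho n (invmx M) = invmx (rho n M).
Proof.
move=> uM; have E : rho n M *m rho n (invmx M) = 1%:M by rewrite rho_mul mulmxV // rho_1.
have [uR _] := mulmx1_unit E; split=> //.
by rewrite -[LHS]mul1mx -(mulVmx uR) -mulmxA E mulmx1.
Qed.

End Tate.

(** * Limits and values of hyperderivatives *)

Section Limits.
Variables (R : realType) (C : ultraFieldType R).
Implicit Types (u v : nat -> C) (x y z c : C) (f g : nat -> C).

Lemma vcvgP u x : vcvg u x <->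
  forall e : R, 0 < e -> exists N, forall n, (N <= n)%N -> vabs (u n - x) < e.
Proof. exact: (vnullP (fun n => u n - x)). Qed.

Lemma eq_vnull u v : u =1 v -> vnull u -> vnull v.
Proof. by move=> /funext ->. Qed.

Lemma vnullD u v : vnull u -> vnull v -> vnull (fun n => u n + v n).
Proof.
move=> /vnullP u0 /vnullP v0; apply/vnullP => e e0.
have [N uN] := u0 e e0; have [M vM] := v0 e e0.
exists (maxn N M) => n; rewrite geq_max => /andP[Nn Mn].
by rewrite (le_lt_trans (vabsD _ _)) // gt_max uN ?vM.
Qed.

Lemma vnull_le u (B : R) v : (forall n, vabs (u n) <= B * vabs (v n)) ->
  vnull v -> vnull u.
Proof.
move=> uv /vnullP v0; apply/vnullP => e e0.
have B0 : 0 < 1 + `|B| by rewrite ltr_pwDl.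
have [N vN] := v0 (e / (1 + `|B|)) (divr_gt0 e0 B0).
exists N => n Nn; rewrite (le_lt_trans (uv n)) //.
have := vN n Nn; rewrite ltr_pdivlMr // mulrC; apply: le_lt_trans.
by rewrite ler_wpM2r ?vabs_ge0 // (le_trans (ler_norm B)) // lerDr ler01.
Qed.

Lemma vnullZ c u : vnull u -> vnull (fun n => c * u n).
Proof. by apply: (@vnull_le _ (vabs c)) => n; rewrite vabsM. Qed.

Lemma vnull_shift k u : vnull u -> vnull (fun n => u (n + k)%N).
Proof.
move=> /vnullP u0; apply/vnullP => e /u0[N uN]; exists N => n Nn.
by rewrite uN // (leq_trans Nn) // leq_addr.
Qed.

Lemma vnull_unshift u : vnull (fun n => u n.+1) -> vnull u.
Proof.
move=> /vnullP u0; apply/vnullP => e /u0[N uN]; exists N.+1 => -[//|n].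
exact: uN.
Qed.

Lemma vcvg_unique u x y : vcvg u x -> vcvg u y -> x = y.
Proof.
move=> /vcvgP ux /vcvgP uy; apply/eqP; rewrite -subr_eq0 -vabs_eq0.
rewrite eq_le vabs_ge0 andbT; apply/ler_addgt0Pr => e e0; rewrite add0r.
have [N uN] := ux e e0; have [M uM] := uy e e0.
have := uN (maxn N M) (leq_maxl _ _); have := uM (maxn N M) (leq_maxr _ _).
set w := u _ => wy wx; rewrite (_ : x - y = (w - y) - (w - x)).
  by rewrite (le_trans (vabsD _ _)) // ge_max vabsN !ltW.
by rewrite opprB [RHS]addrC addrA subrK.
Qed.

Lemma vcvgD u v x y : vcvg u x -> vcvg v y -> vcvg (fun n => u n + v n) (x + y).
Proof.
move=> ux vy; rewrite /vcvg; have := vnullD ux vy; rewrite /vnull.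
by under eq_fun do rewrite addrACA -opprD.
Qed.

Lemma vcvgZ c u x : vcvg u x -> vcvg (fun n => c * u n) (c * x).
Proof.
move=> ux; rewrite /vcvg; have := vnullZ c ux; rewrite /vnull.
by under eq_fun do rewrite mulrBr.
Qed.

Lemma eq_vcvg u v x : u =1 v -> vcvg u x -> vcvg v x.
Proof. by move=> /funext ->. Qed.

Lemma vcvg_cst x : vcvg (fun=> x) x.
Proof. by apply/vcvgP => e e0; exists 0%N => n _; rewrite subrr vabs0. Qed.

Lemma vnull_cvg0 u : vnull u -> vcvg u 0.
Proof. by rewrite /vcvg; under eq_fun do rewrite subr0. Qed.

Lemma vcvg_vabs_le u x (B : R) : 0 <= B -> (forall n, vabs (u n) <= B) ->
  vcvg u x -> vabs x <= B.
Proof.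
move=> B0 uB /vcvgP ux; apply/ler_addgt0Pr => e e0.
have [M uM] := ux e e0.
rewrite -(subrK (u M) x) (le_trans (vabsD _ _)) // ge_max -vabsN opprB.
by rewrite (le_trans (ltW (uM M _))) ?lerDr // (le_trans (uB M)) // lerDl ltW.
Qed.

(* Coefficients of ('X - z) * f. *)
Definition mul_Xsub z f : nat -> C :=
  fun n => (if n is n'.+1 then f n' else 0) - z * f n.

Definition cst_fps c : nat -> C := fun n => if n is 0%N then c else 0.

(** Stated for bare coefficient sequences, so that the polar and analytic parts of a series can be
    treated separately without placing each in [tate C]. *)
Definition hyper_value s f z x :=
  vcvg (fun n => \sum_(i < n) (f (i + s)%N *+ 'C(i + s, s)) * z ^+ i) x.

(** Over a complete ultrametric field this is convergence on the closed disc of radius |z|. *)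
Definition decays z f := vnull (fun n => f n * z ^+ n).

Lemma decays_mul_Xsub z f : decays z f -> decays z (mul_Xsub z f).
Proof.
move=> fz; apply: vnull_unshift.
apply: eq_vnull (vnullD (vnullZ z fz) (vnullZ (- z) (vnull_shift 1 fz))) => n.
by rewrite /mul_Xsub addn1 exprS; ring.
Qed.

Lemma decays_cst z c : decays z (cst_fps c).
Proof. by apply/vnullP => e e0; exists 1%N => -[//|n] _; rewrite mul0r vabs0. Qed.

Lemma decaysD z f g : decays z f -> decays z g -> decays z (fun n => f n + g n).
Proof.
move=> fz gz; have := vnullD fz gz; rewrite /decays /vnull.
by under eq_fun do rewrite -mulrDl.
Qed.

Lemma hyper_valueD s f g z x y : hyper_value s f z x -> hyper_value s g z y ->
  hyper_value s (fun n => f n + g n) z (x + y).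
Proof.
move=> fx gy; apply: eq_vcvg (vcvgD fx gy) => n; rewrite -big_split /=.
by apply: eq_bigr => i _; rewrite mulrnDl mulrDl.
Qed.

Lemma hyper_value_cst0 z c : hyper_value 0 (cst_fps c) z c.
Proof.
apply/vcvgP => e e0; exists 1%N => -[//|n] _.
rewrite big_ord_recl big1 ?addr0 => [|i _]; last by rewrite /= addn0 bin0 mul0r.
by rewrite /= mulr1n expr0 mulr1 subrr vabs0.
Qed.

Lemma hyper_value_cstS s z c : hyper_value s.+1 (cst_fps c) z 0.
Proof.
apply/vcvgP => e e0; exists 0%N => n _; rewrite big1 ?subrr ?vabs0 // => i _.
by rewrite addnS /= mul0rn mul0r.
Qed.

Lemma hyper_value_mul0 z f : decays z f -> hyper_value 0 (mul_Xsub z f) z 0.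
Proof.
move=> fz; apply: vnull_cvg0; apply: vnull_unshift.
apply: (@vnull_le _ (vabs z)) fz => n; rewrite -vabsM -vabsN.
(* The partial sums telescope to a single boundary term. *)
suff -> : \sum_(i < n.+1) (mul_Xsub z f (i + 0) *+ 'C(i + 0, 0)) * z ^+ i =
    - (z * (f n * z ^+ n)).
  by rewrite opprK.
elim: n => [|n IHn].
  by rewrite big_ord1 addn0 bin0 mulr1n /mul_Xsub /= sub0r !expr0 !mulr1.
by rewrite big_ord_recr /= IHn /mul_Xsub addn0 bin0 mulr1n exprS; ring.
Qed.

(** By Leibniz the hyperderivative of order s + 1 of (t - z) f is that of order s of f, plus a
    multiple of t - z. On partial sums the multiple of t - z is the telescoped boundary term [w],
    which tends to 0. *)
Lemma hyper_value_mulS s z f x : z != 0 -> decays z f -> hyper_value s f z x ->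
  hyper_value s.+1 (mul_Xsub z f) z x.
Proof.
move=> z0 fz fx; rewrite -[x]addr0.
pose w n := - ((f (n + s)%N * z ^+ n) *+ 'C(n + s, s.+1)).
have w0 : vnull w.
  apply: (@vnull_le _ (vabs (z ^- s))) (vnull_shift s fz) => n.
  rewrite /w vabsN -vabsM exprD.
  have -> : z ^- s * (f (n + s)%N * (z ^+ n * z ^+ s)) = f (n + s)%N * z ^+ n.
    by rewrite mulrCA [X in _ * X]mulrCA mulVf ?expf_neq0 // mulr1.
  by rewrite -mulr_natr vabsM ler_piMr ?vabs_ge0 // vabs_natr_le1.
apply: eq_vcvg (vcvgD fx (vnull_cvg0 w0)) => n; rewrite /w.
elim: n => [|n IHn].
  by rewrite !big_ord0 add0r bin_small // mulr0n oppr0.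
rewrite [RHS]big_ord_recr -IHn big_ord_recr /= /mul_Xsub addnS addSn binS exprS.
rewrite -(mulr_natr (f (n + s)%N)) -(mulr_natr (f (n + s).+1 * _)).
rewrite -(mulr_natr (f (n + s)%N * _)) -(mulr_natr (f (n + s)%N - _)) natrD.
by ring.
Qed.

(** Multiplication by t - z lowers the pole order and releases the constant - c, which joins the
    analytic part: the shape polar plus analytic is preserved. *)
Lemma mul_XsubD_polar z (u w v : nat -> C) c :
  (forall n, mul_Xsub z u n = v n - cst_fps c n) ->
  mul_Xsub z (fun n => u n + w n) = fun n => v n + (mul_Xsub z w n + cst_fps (- c) n).
Proof.
move=> uv; apply/funext => n; transitivity (mul_Xsub z u n + mul_Xsub z w n).
  by rewrite /mul_Xsub; case: n => [|n]; ring.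
by rewrite uv; case: n => [|n] /=; ring.
Qed.

(** Multiplied by (t - z)^k, the polar part becomes a polynomial of degree < k in t - z, so the
    orders s + k see only the analytic part [w]. *)
Lemma hyper_value_polar_ge z k (v : nat -> nat -> C) (c : nat -> C) w s x : z != 0 ->
    (forall a n, mul_Xsub z (v a) n = v a.+1 n - cst_fps (c a) n) ->
    (forall n, v k n = 0) -> decays z w -> hyper_value s w z x ->
  hyper_value (s + k) (iter k (mul_Xsub z) (fun n => v 0%N n + w n)) z x.
Proof.
move=> z0; elim: k v c w s x => [|k IHk] v c w s x vS vk wz wx.
  by rewrite addn0; apply: eq_vcvg wx => n; apply: eq_bigr => i _ /=; rewrite vk add0r.
rewrite iterSr (mul_XsubD_polar w (vS 0%N)) -addSnnS.
apply: (IHk (fun a => v a.+1) (fun a => c a.+1)) => //.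
  exact/decaysD/decays_cst/decays_mul_Xsub.
rewrite -[x]addr0; apply: hyper_valueD; last exact: hyper_value_cstS.
exact: hyper_value_mulS.
Qed.

(* [v 0] is the expansion at 0 of a rational function with principal part
   - \sum_a c a / (t - z)^(a + 1) at [z], and [w] is analytic at [z]. *)
Lemma hyper_value_polar z k (v : nat -> nat -> C) (c : nat -> C) w s : z != 0 ->
    (forall a n, mul_Xsub z (v a) n = v a.+1 n - cst_fps (c a) n) ->
    (forall n, v k n = 0) -> decays z w -> (s < k)%N ->
  hyper_value s (iter k (mul_Xsub z) (fun n => v 0%N n + w n)) z (- c (k - s.+1)%N).
Proof.
move=> z0; elim: k v c w s => // k IHk v c w s vS vk wz.
have wz' : decays z (fun n => mul_Xsub z w n + cst_fps (- c 0%N) n).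
  exact/decaysD/decays_cst/decays_mul_Xsub.
rewrite ltnS leq_eqVlt iterSr (mul_XsubD_polar w (vS 0%N)) => /orP[/eqP->|sk].
  (* Top order: it reads off the value at z of the new analytic part (t - z) w - c 0. Lower orders
     follow by induction. *)
  have V : hyper_value 0 (fun n => mul_Xsub z w n + cst_fps (- c 0%N) n) z (0 - c 0%N).
    by apply: hyper_valueD; [exact: hyper_value_mul0 | exact: hyper_value_cst0].
  rewrite sub0r in V.
  by rewrite subnn; apply: (hyper_value_polar_ge z0 (fun a => vS a.+1) vk wz' V).
by rewrite subSS -(subnSK sk); apply: (IHk (fun a => v a.+1) (fun a => c a.+1)).
Qed.

End Limits.

(** * Frobenius on the Tate algebra *)

Section Frobenius.
Variables (Fq : finFieldType) (L : fieldType) (s : {rmorphism Fq -> L}).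
Local Notation q := #|Fq|.

Lemma card_gt0 i : (0 < q ^ i)%N.
Proof. by rewrite expn_gt0 (ltnW (finNzRing_gt1 Fq)). Qed.

Lemma frob0 i : (0 : L) ^+ (q ^ i) = 0.
Proof. by rewrite expr0n (gtn_eqF (card_gt0 i)). Qed.

Lemma frobD i (x y : L) : (x + y) ^+ (q ^ i) = x ^+ (q ^ i) + y ^+ (q ^ i).
Proof.
have [p p_pr pF] := finPcharP Fq.
have pL : p \in [pchar L] by rewrite inE p_pr -(rmorph_nat s) (pcharf0 pF) rmorph0 eqxx.
have qp : p.-nat q by rewrite (card_pprimeChar pF) pnatX pnat_id.
by apply: exprDn_pchar; rewrite (eq_pnat _ (pcharf_eq pL)) pnatX qp.
Qed.

Lemma frob_sum i I (r : seq I) (P : pred I) (F : I -> L) :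
  (\sum_(k <- r | P k) F k) ^+ (q ^ i) = \sum_(k <- r | P k) F k ^+ (q ^ i).
Proof. exact: (big_morph (fun x => x ^+ (q ^ i)) (frobD i) (frob0 i)). Qed.

Lemma frobN i (x : L) : (- x) ^+ (q ^ i) = - x ^+ (q ^ i).
Proof. by apply/eqP; rewrite -addr_eq0 -frobD addNr frob0. Qed.

Lemma frob_fixed (x : L) : x ^+ q = x -> exists a, s a = x.
Proof.
move=> xq; have /(congr1 (fun p => (map_poly s p).[x])) := finField_genPoly Fq.
rewrite rmorphB /= map_polyXn map_polyX !hornerE xq subrr rmorph_prod horner_prod.
move=> /esym/eqP/prodf_eq0[a _]; rewrite rmorphB /= map_polyX map_polyC !hornerE.
by rewrite subr_eq0 => /eqP ->; exists a.
Qed.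

End Frobenius.

Section TatePoly.
Variables (R : realType) (C : ultraFieldType R).

Fact tate_poly_zmod_morphism : zmod_morphism (@tate_poly R C).
Proof. by move=> p q; apply: tateP => n; rewrite tatevalD tatevalN -coefB. Qed.

HB.instance Definition _ :=
  GRing.isZmodMorphism.Build {poly C} (tate C) (@tate_poly R C) tate_poly_zmod_morphism.

Fact tate_poly_monoid_morphism : monoid_morphism (@tate_poly R C).
Proof.
split=> [|p q]; apply: tateP => n; first by rewrite tateval1 -coef1.
by rewrite tatevalM -coefM.
Qed.

HB.instance Definition _ :=
  GRing.isMonoidMorphism.Build {poly C} (tate C) (@tate_poly R C) tate_poly_monoid_morphism.

Lemma tatevalZ c (f : tate C) n : tateval (tate_poly c%:P * f) n = c * tateval f n.
Proof.
rewrite tatevalM big_ord_recl subn0 /= coefC eqxx big1 ?addr0 // => i _.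
by rewrite coefC mul0r.
Qed.

Lemma tateval_Xmul (f : tate C) n :
  tateval (tate_poly 'X * f) n = if n is n'.+1 then tateval f n' else 0.
Proof.
rewrite tatevalM big_ord_recl /= coefX mul0r add0r.
case: n => [|n]; first by rewrite big_ord0.
rewrite big_ord_recl /= coefX mul1r subSS subn0 big1 ?addr0 // => i _.
by rewrite coefX mul0r.
Qed.

Lemma tateval_mul_Xsub z (f : tate C) n :
  tateval (tate_poly ('X - z%:P) * f) n = mul_Xsub z (tateval f) n.
Proof. by rewrite rmorphB mulrBl tatevalD tatevalN tateval_Xmul tatevalZ. Qed.

Lemma tateval_iter_mul_Xsub z k (f : tate C) :
  tateval (tate_poly (('X - z%:P) ^+ k) * f) = iter k (mul_Xsub z) (tateval f).
Proof.
elim: k => [|k IHk]; first by rewrite expr0 rmorph1 mul1r.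
apply/funext => n; rewrite exprS rmorphM -mulrA tateval_mul_Xsub IHk.
by rewrite iterS.
Qed.

Lemma vnull_exp (x : C) : vabs x < 1 -> vnull (fun n => x ^+ n).
Proof.
move=> x1; rewrite /vnull; under eq_fun do rewrite vabsX.
by apply: cvg_expr; rewrite ger0_norm ?vabs_ge0.
Qed.

(** The inverse is the geometric series - sum_n z^(-n-1) t^n, whose coefficients tend to 0. *)
Lemma tate_unit_Xsub (z : C) : 1 < vabs z -> tate_poly ('X - z%:P) \is a GRing.unit.
Proof.
move=> z1; have z0 : z != 0 by rewrite -vabs_eq0 gt_eqF // (lt_trans ltr01).
have zV1 : vabs z^-1 < 1.
  have := vabsM z z^-1; rewrite mulfV // vabs1 => E.
  by rewrite -(ltr_pM2l (lt_trans ltr01 z1)) -E mulr1.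
have gP : (fun n => - z^-1 ^+ n.+1) \in @tate_pred R C.
  rewrite unfold_in; apply/asboolP.
  by apply: (@vnull_le _ _ _ 1) (vnull_shift 1 (vnull_exp zV1)) => n; rewrite vabsN addn1 mul1r.
apply/unitrP; exists (Tate gP).
suff E : tate_poly ('X - z%:P) * Tate gP = 1 by rewrite mulrC E.
apply: tateP => n; rewrite tateval_mul_Xsub tateval1 /mul_Xsub /=.
case: n => [|n]; first by rewrite expr1 mulrN mulfV // opprK add0r.
by rewrite mulrN opprK [z^-1 ^+ n.+2]exprS mulrA mulfV // mul1r addNr.
Qed.

End TatePoly.

Section TateFrobenius.
Variables (Fq : finFieldType) (R : realType) (C : ultraFieldType R).
Variable s : {rmorphism Fq -> C}.
Implicit Types f g : tate C.

Lemma tateval_tau f n : tateval (tate_tau Fq f) n = tateval f n ^+ #|Fq|.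
Proof. by []. Qed.

(* [tate_tau] is a ring morphism because [C] has the characteristic of [Fq],
   as the phantom argument witnesses. *)
Definition tate_frob of {rmorphism Fq -> C} : tate C -> tate C := tate_tau Fq.

Fact tate_frob_zmod_morphism : zmod_morphism (tate_frob s).
Proof.
move=> f g; apply: tateP => n; rewrite tatevalD tatevalN !tateval_tau tatevalD tatevalN.
by have := frobD s 1 (tateval f n) (- tateval g n); rewrite (frobN s) !expn1.
Qed.

HB.instance Definition _ :=
  GRing.isZmodMorphism.Build (tate C) (tate C) (tate_frob s) tate_frob_zmod_morphism.

Fact tate_frob_monoid_morphism : monoid_morphism (tate_frob s).
Proof.
split=> [|f g]; apply: tateP => n.
  by rewrite tateval_tau tateval1; case: n => [|n]; rewrite ?expr1n // -[#|Fq|]expn1 (frob0 Fq).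
rewrite tateval_tau !tatevalM; have := frob_sum s 1; rewrite expn1 => ->.
by apply: eq_bigr => i _; rewrite exprMn.
Qed.

HB.instance Definition _ :=
  GRing.isMonoidMorphism.Build (tate C) (tate C) (tate_frob s) tate_frob_monoid_morphism.

(** The coefficients are roots of X^q - X, hence lie in F_q and have absolute value 0 or 1. As they
    tend to 0, almost all of them vanish. *)
Lemma tate_tau_fixed f : tate_tau Fq f = f -> exists a, f = tate_poly (map_poly s a).
Proof.
move=> ff; have fq n : tateval f n ^+ #|Fq| = tateval f n by rewrite -tateval_tau ff.
have /boolp.choice[a sa] : forall n, exists a, s a = tateval f n.
  by move=> n; apply: frob_fixed.
have /asboolP f0 := tatevalP f; have [N fN] := (vnullP _).1 f0 1 ltr01.
have {}f0 n : (N <= n)%N -> tateval f n = 0.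
  move=> /fN fn; apply/eqP; rewrite -vabs_eq0; apply: contraTT fn => fn0.
  rewrite -leNgt; have := congr1 (@vabs _ _) (fq n).
  rewrite vabsX -(prednK (ltnW (finNzRing_gt1 Fq))) exprS.
  rewrite -[RHS]mulr1 => /(mulfI fn0) fn1.
  rewrite -(@ler_pXn2r _ #|Fq|.-1) ?nnegrE ?vabs_ge0 ?ler01 ?expr1n ?fn1 //.
  by rewrite -ltnS prednK ?finNzRing_gt1 // ltnW ?finNzRing_gt1.
exists (\poly_(i < N) a i); apply: tateP => n /=.
rewrite coef_map coef_poly; case: ltnP => [_|/f0 ->].
  exact/esym/sa.
exact/esym/(rmorph0 s).
Qed.

End TateFrobenius.

(** * The motive *)

Section Twisted.
Variables (Fq : finFieldType) (K : fieldExtType {fraction {poly Fq}}).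
Local Notation q := #|Fq|.
Implicit Types (f g : twpoly K) (c : K).

Definition scalarK : {rmorphism Fq -> K} :=
  (in_alg K \o @tofrac {poly Fq}) \o @polyC Fq.

Lemma twpolyP f g : (forall n, twcoef f n = twcoef g n) -> f = g.
Proof. by move=> fg; apply/polyP. Qed.

Lemma twcoefD f g n : twcoef (f + g) n = twcoef f n + twcoef g n.
Proof. exact: coefD. Qed.

Lemma twcoefB f g n : twcoef (f - g) n = twcoef f n - twcoef g n.
Proof. exact: coefB. Qed.

Lemma twcoef0 n : twcoef (0 : twpoly K) n = 0.
Proof. exact: coef0. Qed.

Lemma twcoef_mul f g n :
  twcoef (f * g) n = \sum_(i < n.+1) twcoef f i * twcoef g (n - i) ^+ (q ^ i).
Proof. exact: twcoefM. Qed.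

Lemma twcoef_sum I (r : seq I) (P : pred I) (F : I -> twpoly K) n :
  twcoef (\sum_(i <- r | P i) F i) n = \sum_(i <- r | P i) twcoef (F i) n.
Proof. exact: (big_morph _ (fun f g => twcoefD f g n) (twcoef0 n)). Qed.

Lemma twcoefC c n : twcoef (twconst c) n = if n == 0%N then c else 0.
Proof. exact: coefC. Qed.

Lemma twcoef_tau n : twcoef (twtau K) n = (n == 1%N)%:R.
Proof. exact: coefX. Qed.

Lemma twcoef_mulC c f n : twcoef (twconst c * f) n = c * twcoef f n.
Proof.
rewrite twcoef_mul big_ord_recl subn0 twcoefC expr1 big1 ?addr0 // => i _.
by rewrite twcoefC mul0r.
Qed.

Lemma twcoef_mul_tau f n :
  twcoef (twtau K * f) n = if n is n'.+1 then twcoef f n' ^+ q else 0.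
Proof.
rewrite twcoef_mul big_ord_recl twcoef_tau mul0r add0r.
case: n => [|n]; first by rewrite big_ord0.
rewrite big_ord_recl twcoef_tau mul1r subSS subn0 expn1 big1 ?addr0 // => i _.
by rewrite twcoef_tau mul0r.
Qed.

Lemma twcoef_tau_exp k n : twcoef (twtau K ^+ k) n = (n == k)%:R.
Proof.
elim: k n => [|k IHk] n; first by rewrite [LHS]twcoefC; case: n.
rewrite exprS twcoef_mul_tau; case: n => // n; rewrite IHk eqSS.
by case: eqP; rewrite ?expr1n // -[q]expn1 (frob0 Fq).
Qed.

Lemma twtau_const c : twtau K * twconst c = twconst (c ^+ q) * twtau K.
Proof.
apply: twpolyP => n; rewrite twcoef_mul_tau twcoef_mulC twcoef_tau.
case: n => [|[|n]]; rewrite ?mulr0 // twcoefC ?mulr1 //=.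
by rewrite -[q]expn1 (frob0 Fq).
Qed.

Lemma twpoly_sum n f : (twsize f <= n)%N ->
  f = \sum_(i < n) twconst (twcoef f i) * twtau K ^+ i.
Proof.
move=> fn; apply: twpolyP => k; rewrite twcoef_sum.
under eq_bigr do rewrite twcoef_mulC twcoef_tau_exp.
have [kn|nk] := ltnP k n; last first.
  rewrite big1 => [|i _]; first by rewrite [LHS]nth_default // (leq_trans fn nk).
  by rewrite gtn_eqF ?mulr0 // (leq_trans (ltn_ord i)).
rewrite (bigD1 (Ordinal kn)) //= eqxx mulr1 big1 ?addr0 // => i ik.
by rewrite eq_sym (negPf (_ : i != k :> nat)) ?mulr0.
Qed.

Fact twconst_zmod_morphism : zmod_morphism (@twconst Fq K).
Proof. by move=> a b; exact: polyCB. Qed.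
HB.instance Definition _ :=
  GRing.isZmodMorphism.Build K (twpoly K) (@twconst Fq K) twconst_zmod_morphism.

Fact twconst_monoid_morphism : monoid_morphism (@twconst Fq K).
Proof.
split=> // a b; apply: twpolyP => n; rewrite twcoef_mulC !twcoefC.
by case: ifP; rewrite ?mulr0.
Qed.
HB.instance Definition _ :=
  GRing.isMonoidMorphism.Build K (twpoly K) (@twconst Fq K) twconst_monoid_morphism.

(** Names the linear term so that it can carry a ring morphism structure, through which [twdiff]
    becomes a [map_mx]. *)
Definition twcoef0th (f : twpoly K) : K := twcoef f 0.

Fact twcoef0th_zmod_morphism : zmod_morphism twcoef0th.
Proof. by move=> f g; exact: twcoefB. Qed.
HB.instance Definition _ :=
  GRing.isZmodMorphism.Build (twpoly K) K twcoef0th twcoef0th_zmod_morphism.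

Fact twcoef0th_monoid_morphism : monoid_morphism twcoef0th.
Proof.
split=> [|f g]; first exact: twcoefC.
by rewrite /twcoef0th twcoef_mul big_ord1 expr1.
Qed.
HB.instance Definition _ :=
  GRing.isMonoidMorphism.Build (twpoly K) K twcoef0th twcoef0th_monoid_morphism.

Lemma twdiffE m n (F : 'M[twpoly K]_(m, n)) : twdiff F = map_mx twcoef0th F.
Proof. by []. Qed.

Lemma twdiffD m n (F G : 'M[twpoly K]_(m, n)) : twdiff (F + G) = twdiff F + twdiff G.
Proof. by rewrite !twdiffE map_mxD. Qed.

Lemma twdiff_sum m n I (r : seq I) (F : I -> 'M[twpoly K]_(m, n)) :
  twdiff (\sum_(i <- r) F i) = \sum_(i <- r) twdiff (F i).
Proof.
by apply: (big_morph _ (@twdiffD m n)); rewrite twdiffE map_mx0.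
Qed.

Lemma twdiffM m n p (F : 'M[twpoly K]_(m, n)) (G : 'M_(n, p)) :
  twdiff (F *m G) = twdiff F *m twdiff G.
Proof. by rewrite !twdiffE map_mxM. Qed.

Lemma twdiff_scalel m n f (F : 'M[twpoly K]_(m, n)) :
  twdiff (f *: F) = twcoef f 0 *: twdiff F.
Proof. by rewrite !twdiffE map_mxZ. Qed.

Lemma twdiff_map_const m n (A : 'M[K]_(m, n)) : twdiff (map_mx (@twconst _ K) A) = A.
Proof. by apply/matrixP => i j; rewrite !mxE twcoefC. Qed.

Lemma coordinate_system_const d (A : 'M[K]_d) :
  A \in unitmx -> coordinate_system (map_mx (@twconst _ K) A).
Proof.
move=> uA; exists (map_mx (@twconst _ K) (invmx A)).
by rewrite -!map_mxM mulVmx // mulmxV // map_mx1.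
Qed.

End Twisted.

Section Motive.
Variables (Fq : finFieldType) (K : fieldExtType {fraction {poly Fq}}).
Variables (d : nat) (E : tmodule K d).
Local Notation q := #|Fq|.
Local Notation act := (motive_act E).
Local Notation N := (twdiff (E 'X)).
Implicit Types (p : {poly K}) (x y : 'rV[twpoly K]_d).

Lemma motive_actE n p x : (size p <= n)%N ->
  act p x = \sum_(i < n) twconst p`_i *: (x *m E 'X^i).
Proof.
move=> pn; rewrite /motive_act (big_ord_widen n (fun i => twconst p`_i *: (x *m E 'X^i))) //.
rewrite big_mkcond /=; apply: eq_bigr => i _; case: ltnP => // /leq_sizeP/(_ i (leqnn i)) ->.
by rewrite rmorph0 scale0r.
Qed.

Lemma motive_actDl p1 p2 x : act (p1 + p2) x = act p1 x + act p2 x.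
Proof.
pose n := maxn (size p1) (size p2).
rewrite !(@motive_actE n) ?leq_maxl ?leq_maxr ?size_polyD // -big_split.
by apply: eq_bigr => i _; rewrite coefD rmorphD scalerDl.
Qed.

Lemma motive_act0l x : act 0 x = 0.
Proof. by rewrite /motive_act size_poly0 big_ord0. Qed.

Lemma motive_actDr p x y : act p (x + y) = act p x + act p y.
Proof.
by rewrite -big_split; apply: eq_bigr => i _; rewrite mulmxDl scalerDr.
Qed.

Lemma motive_act0r p : act p 0 = 0.
Proof. by apply: big1 => i _; rewrite mul0mx scaler0. Qed.

Lemma motive_act_sumr p I (r : seq I) (F : I -> 'rV[twpoly K]_d) :
  act p (\sum_(i <- r) F i) = \sum_(i <- r) act p (F i).
Proof. exact: (big_morph _ (motive_actDr p) (motive_act0r p)). Qed.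

Lemma motive_actC c x : act c%:P x = twconst c *: x.
Proof.
by rewrite (@motive_actE 1) ?size_polyC ?leq_b1 // big_ord1 coefC expr0 rmorph1 mulmx1.
Qed.

Lemma motive_act_mulX p x : act (p * 'X) x = act p x *m E 'X.
Proof.
have [->|p0] := eqVneq p 0; first by rewrite mul0r !motive_act0l mul0mx.
rewrite /motive_act size_mulX // big_ord_recl coefMX /= rmorph0 scale0r add0r.
rewrite mulmx_suml; apply: eq_bigr => i _.
by rewrite coefMX /= -scalemxAl -mulmxA exprSr rmorphM.
Qed.

Lemma motive_actX x : act 'X x = x *m E 'X.
Proof. by rewrite -[X in act X]mul1r motive_act_mulX motive_actC rmorph1 scale1r. Qed.

Lemma motive_actM p1 p2 x : act (p1 * p2) x = act p1 (act p2 x).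
Proof.
elim/poly_ind: p1 => [|p1 c IHp]; first by rewrite mul0r !motive_act0l.
rewrite mulrDl mulrAC !motive_actDl !motive_act_mulX IHp !motive_actC; congr (_ + _).
rewrite mul_polyC /motive_act.
rewrite -!/(motive_act _ _ _) (@motive_actE (size p2)) ?size_scale_leq //.
rewrite /motive_act scaler_sumr; apply: eq_bigr => i _.
by rewrite coefZ rmorphM scalerA.
Qed.

Definition frob_poly p : {poly K} := map_poly (fun c => c ^+ q) p.

Lemma coef_frob_poly p i : (frob_poly p)`_i = p`_i ^+ q.
Proof. by rewrite coef_map_id0 // -[q]expn1 (frob0 Fq). Qed.

Lemma motive_tau_act p x : twtau K *: act p x = act (frob_poly p) (twtau K *: x).
Proof.
rewrite (@motive_actE (size p) (frob_poly p)) ?size_poly // scaler_sumr.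
apply: eq_bigr => i _.
by rewrite scalerA twtau_const coef_frob_poly -scalerA scalemxAl.
Qed.

Lemma twdiff_act_eq0 p x : twdiff x = 0 -> twdiff (act p x) = 0.
Proof.
move=> x0; rewrite twdiff_sum big1 // => i _.
by rewrite twdiff_scalel twdiffM x0 mul0mx scaler0.
Qed.

Lemma twdiff_act_Xsub c k x :
  twdiff (act (('X - c%:P) ^+ k) x) = twdiff x *m (N - c%:M) ^+ k.
Proof.
elim: k => [|k IHk]; first by rewrite !expr0 motive_actC rmorph1 scale1r mulmx1.
rewrite exprS motive_actM; move: (act _ x) IHk => y IHk.
rewrite motive_actDl -polyCN motive_actC motive_actX.
rewrite twdiffD twdiffM twdiff_scalel twcoefC eqxx IHk.
rewrite exprSr mulmxA mulmxDr mulmxN scaleNr.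
by rewrite mul_mx_scalar.
Qed.

Section Basis.
Variables (r : nat) (m : 'I_r -> 'rV[twpoly K]_d).
Implicit Type c : 'rV[{poly K}]_r.

Definition motive_comb c := \sum_i act (c 0 i) (m i).
Local Notation Phi := motive_comb.

Lemma motive_combD c1 c2 : Phi (c1 + c2) = Phi c1 + Phi c2.
Proof.
by rewrite /Phi -big_split; apply: eq_bigr => i _; rewrite mxE motive_actDl.
Qed.

Lemma motive_comb0 : Phi 0 = 0.
Proof. by apply: big1 => i _; rewrite mxE motive_act0l. Qed.

Lemma motive_comb_sum I (s : seq I) (P : pred I) F :
  Phi (\sum_(i <- s | P i) F i) = \sum_(i <- s | P i) Phi (F i).
Proof. exact: (big_morph _ motive_combD motive_comb0). Qed.

Lemma motive_combZ p c : Phi (p *: c) = act p (Phi c).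
Proof.
rewrite /Phi motive_act_sumr; apply: eq_bigr => i _.
by rewrite mxE motive_actM.
Qed.

Lemma motive_comb_mul n (c : 'rV_n) (A : 'M_(n, r)) :
  Phi (c *m A) = \sum_i act (c 0 i) (Phi (row i A)).
Proof.
rewrite mulmx_sum_row motive_comb_sum; apply: eq_bigr => i _.
by rewrite motive_combZ.
Qed.

Hypothesis hm : motive_basis E m.
Variable Theta : 'M[{poly K}]_r.
Hypothesis hTheta : forall i, motive_tau (m i) = \sum_j act (Theta i j) (m j).

Lemma motive_comb_surj x : exists c, x = Phi c.
Proof. by have [c [xc _]] := hm.2 x I; exists c. Qed.

Lemma motive_comb_inj c1 c2 : Phi c1 = Phi c2 -> c1 = c2.
Proof.
move=> e; have [c [_ uc]] := hm.2 (Phi c1) I.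
by rewrite -(uc c1) // -(uc c2).
Qed.

Lemma motive_tau_row i : twtau K *: m i = Phi (row i Theta).
Proof. by rewrite [LHS]hTheta; apply: eq_bigr => j _; rewrite mxE. Qed.

Lemma motive_tau_comb c : twtau K *: Phi c = Phi (map_mx frob_poly c *m Theta).
Proof.
rewrite motive_comb_mul scaler_sumr; apply: eq_bigr => i _.
by rewrite motive_tau_act motive_tau_row mxE.
Qed.

Lemma twdiff_comb_theta c : twdiff (Phi (c *m Theta)) = 0.
Proof.
rewrite motive_comb_mul twdiff_sum big1 // => i _.
rewrite twdiff_act_eq0 // -motive_tau_row twdiff_scalel.
by rewrite twcoef_tau scale0r.
Qed.

(* The kernel of [twdiff] on the motive is the K[t]-span of its Frobenius image. *)
Lemma twdiff_comb_eq0 c : twdiff (Phi c) = 0 -> exists b, c = b *m Theta.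
Proof.
pose Z (x : 'rV[twpoly K]_d) := exists b, x = Phi (b *m Theta).
move=> c0; suff [b] : Z (Phi c) by move=> /motive_comb_inj ->; exists b.
have ZD x y : Z x -> Z y -> Z (x + y).
  by move=> [b ->] [b' ->]; exists (b + b'); rewrite mulmxDl motive_combD.
have Z0 : Z 0 by exists 0; rewrite mul0mx motive_comb0.
have Zsum I (s : seq I) (F : I -> 'rV[twpoly K]_d) :
      (forall i, Z (F i)) -> Z (\sum_(i <- s) F i).
  by move=> ZF; apply: big_ind.
(* A twisted polynomial without linear term is a sum of terms c tau^(i+1), so it is enough that the
   span contains every multiple c tau x. *)
have Ztau k x : Z (twconst k *: (twtau K *: x)).
  have [b ->] := motive_comb_surj x; exists (k%:P *: map_mx frob_poly b).
  by rewrite motive_tau_comb -scalemxAl motive_combZ motive_actC.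
have -> := row_sum_delta (Phi c); apply: (Zsum) => l.
have f0 : twcoef (Phi c 0 l) 0 = 0 by have /rowP/(_ l) := c0; rewrite !mxE.
rewrite [Phi c 0 l](twpoly_sum (leqnSn (twsize (Phi c 0 l)))) scaler_suml; apply: Zsum => i.
case: i => -[|i] /= _; first by rewrite f0 rmorph0 mul0r scale0r.
by rewrite exprS -!scalerA.
Qed.

End Basis.
End Motive.

(** * Points over the Tate algebra *)

Section Evaluation.
Variables (Fq : finFieldType) (K : fieldExtType {fraction {poly Fq}}).
Variables (R : realType) (C : ultraFieldType R) (iota : {rmorphism K -> C}).
Local Notation q := #|Fq|.
Implicit Types f g : twpoly K.

Definition scalarC : {rmorphism Fq -> C} := iota \o @scalarK Fq K.
Local Notation sC := scalarC.
Local Notation twev := (tw_eval iota).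

Lemma tw_evalE n f x : (twsize f <= n)%N ->
  twev f x = \sum_(i < n) iota (twcoef f i) * x ^+ (q ^ i).
Proof.
move=> fn; rewrite /tw_eval (big_ord_widen n (fun i => iota (twcoef f i) * x ^+ (q ^ i))) //.
rewrite big_mkcond /=; apply: eq_bigr => i _; case: ltnP => // fi.
by rewrite [twcoef f i]nth_default // rmorph0 mul0r.
Qed.

Lemma tw_evalDl f g x : twev (f + g) x = twev f x + twev g x.
Proof.
pose n := maxn (twsize f) (twsize g).
rewrite !(@tw_evalE n) ?leq_maxl ?leq_maxr ?size_polyD // -big_split.
by apply: eq_bigr => i _; rewrite twcoefD rmorphD mulrDl.
Qed.

Lemma tw_eval0l x : twev 0 x = 0.
Proof. by rewrite /tw_eval /twsize size_poly0 big_ord0. Qed.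

Lemma tw_eval_suml I (r : seq I) (F : I -> twpoly K) x :
  twev (\sum_(i <- r) F i) x = \sum_(i <- r) twev (F i) x.
Proof. exact: (big_morph _ (fun f g => tw_evalDl f g x) (tw_eval0l x)). Qed.

Lemma tw_evalD f x y : twev f (x + y) = twev f x + twev f y.
Proof.
by rewrite -big_split; apply: eq_bigr => i _; rewrite (frobD sC) mulrDr.
Qed.

Lemma tw_eval0 f : twev f 0 = 0.
Proof. by apply: big1 => i _; rewrite (frob0 Fq) mulr0. Qed.

Lemma tw_eval_sum I (r : seq I) (F : I -> C) f :
  twev f (\sum_(i <- r) F i) = \sum_(i <- r) twev f (F i).
Proof. exact: (big_morph _ (tw_evalD f) (tw_eval0 f)). Qed.

Lemma tw_eval_mulC c f x : twev (twconst c * f) x = iota c * twev f x.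
Proof.
pose n := maxn (twsize f) (twsize (twconst c * f)).
rewrite !(@tw_evalE n) ?leq_maxl ?leq_maxr // mulr_sumr.
by apply: eq_bigr => i _; rewrite twcoef_mulC rmorphM mulrA.
Qed.

Lemma tw_eval_mul_tau f x : twev (twtau K * f) x = twev f x ^+ q.
Proof.
pose n := maxn (twsize f) (twsize (twtau K * f)).
rewrite (@tw_evalE n.+1) ?leqW ?leq_maxr // (@tw_evalE n) ?leq_maxl //.
rewrite big_ord_recl twcoef_mul_tau rmorph0 mul0r add0r.
have := frob_sum sC 1; rewrite expn1 => ->; apply: eq_bigr => i _.
by rewrite twcoef_mul_tau exprMn -rmorphXn -exprM -expnSr.
Qed.

Lemma tw_eval1 x : twev 1 x = x.
Proof.
rewrite (@tw_evalE 1) ?big_ord1; first by rewrite [twcoef 1 0]twcoefC rmorph1 mul1r expr1.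
by rewrite [twsize _]size_poly1.
Qed.

Lemma tw_eval_const c x : twev (twconst c) x = iota c * x.
Proof. by rewrite -[twconst c]mulr1 tw_eval_mulC tw_eval1. Qed.

Lemma tw_evalM f g x : twev (f * g) x = twev f (twev g x).
Proof.
rewrite {1}(twpoly_sum (leqnn (twsize f))) mulr_suml tw_eval_suml.
apply: eq_bigr => i _; rewrite -mulrA tw_eval_mulC; congr (_ * _).
elim: (nat_of_ord i) => [|k IHk]; first by rewrite mul1r expr1.
by rewrite exprS -mulrA tw_eval_mul_tau IHk -exprM -expnSr.
Qed.

Lemma tw_actD m n (F : 'M[twpoly K]_(m, n)) z w :
  tw_act iota F (z + w) = tw_act iota F z + tw_act iota F w.
Proof.
apply/colP => i; rewrite !mxE -big_split; apply: eq_bigr => j _.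
by rewrite mxE tw_evalD.
Qed.

Lemma tw_act0 m n (F : 'M[twpoly K]_(m, n)) : tw_act iota F 0 = 0.
Proof. by apply/colP => i; rewrite !mxE big1 // => j _; rewrite mxE tw_eval0. Qed.

Lemma tw_actM m n p (F : 'M[twpoly K]_(m, n)) (G : 'M_(n, p)) z :
  tw_act iota (F *m G) z = tw_act iota F (tw_act iota G z).
Proof.
apply/colP => i; rewrite !mxE.
under eq_bigr do rewrite mxE tw_eval_suml.
rewrite exchange_big; apply: eq_bigr => k _; rewrite mxE tw_eval_sum.
by apply: eq_bigr => j _; rewrite tw_evalM.
Qed.

Lemma tw_actDl m n (F G : 'M[twpoly K]_(m, n)) z :
  tw_act iota (F + G) z = tw_act iota F z + tw_act iota G z.
Proof.
apply/colP => i; rewrite !mxE -big_split; apply: eq_bigr => j _.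
by rewrite mxE tw_evalDl.
Qed.

Lemma tw_act_scalel m n f (F : 'M[twpoly K]_(m, n)) z :
  tw_act iota (f *: F) z = map_mx (twev f) (tw_act iota F z).
Proof.
by apply/colP => i; rewrite !mxE tw_eval_sum; apply: eq_bigr => j _; rewrite mxE tw_evalM.
Qed.

Fact poly_tate_zmod_morphism : zmod_morphism (@poly_tate Fq K R C iota).
Proof. by move=> a b; rewrite /poly_tate !rmorphB. Qed.
HB.instance Definition _ := GRing.isZmodMorphism.Build {poly K} (tate C)
  (@poly_tate Fq K R C iota) poly_tate_zmod_morphism.

Fact poly_tate_monoid_morphism : monoid_morphism (@poly_tate Fq K R C iota).
Proof. by split=> [|a b]; rewrite /poly_tate ?rmorph1 ?rmorphM. Qed.
HB.instance Definition _ := GRing.isMonoidMorphism.Build {poly K} (tate C)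
  (@poly_tate Fq K R C iota) poly_tate_monoid_morphism.

Section TatePoints.
Variables (d : nat).
Implicit Types (e : 'cV[tate C]_d) (x : 'rV[twpoly K]_d).

Definition tate_twev f (u : tate C) : tate C :=
  \sum_(i < twsize f) tate_poly (iota (twcoef f i))%:P * iter i (tate_tau Fq) u.

Lemma tateval_twev f u n : tateval (tate_twev f u) n = twev f (tateval u n).
Proof.
rewrite tateval_sum; apply: eq_bigr => i _; rewrite tatevalZ; congr (_ * _).
elim: (nat_of_ord i) => [|k IHk]; first by rewrite expr1.
by rewrite iterS tateval_tau IHk -exprM -expnSr.
Qed.

Definition coef_col e n : 'cV[C]_d := \col_l tateval (e l 0) n.

(** The value of the homomorphism x : E -> G_a at the point e of E over the Tate algebra. *)
Definition pairing x e : tate C := \sum_l tate_twev (x 0 l) (e l 0).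

Lemma tateval_pairing x e n :
  tateval (pairing x e) n = tw_act iota x (coef_col e n) 0 0.
Proof.
rewrite tateval_sum mxE; apply: eq_bigr => l _.
by rewrite tateval_twev mxE.
Qed.

Lemma pairingD x y e : pairing (x + y) e = pairing x e + pairing y e.
Proof.
by apply: tateP => n; rewrite tatevalD !tateval_pairing tw_actDl mxE.
Qed.

Lemma pairing0 e : pairing 0 e = 0.
Proof.
by apply: tateP => n; rewrite tateval_pairing mxE big1 // => l _; rewrite mxE tw_eval0l.
Qed.

Lemma pairing_sum I (r : seq I) (F : I -> 'rV[twpoly K]_d) e :
  pairing (\sum_(i <- r) F i) e = \sum_(i <- r) pairing (F i) e.
Proof. exact: (big_morph _ (fun x y => pairingD x y e) (pairing0 e)). Qed.

Lemma pairing_const c x e :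
  pairing (twconst c *: x) e = tate_poly (iota c)%:P * pairing x e.
Proof.
apply: tateP => n; rewrite tatevalZ !tateval_pairing tw_act_scalel mxE.
by rewrite tw_eval_const.
Qed.

Lemma pairing_tau x e : pairing (twtau K *: x) e = tate_tau Fq (pairing x e).
Proof.
apply: tateP => n; rewrite tateval_tau !tateval_pairing tw_act_scalel mxE.
by rewrite -[twtau K]mulr1 tw_eval_mul_tau tw_eval1.
Qed.

Lemma pairing_delta l e : pairing (delta_mx 0 l) e = e l 0.
Proof.
apply: tateP => n; rewrite tateval_pairing mxE (bigD1 l) //= mxE !eqxx.
rewrite tw_eval1 mxE big1 ?addr0 // => k kl.
by rewrite mxE (negPf kl) tw_eval0l.
Qed.

Variable E : tmodule K d.

(* The points e of E over the Tate algebra with phi_t(e) = t e. *)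
Definition is_tower e := forall n,
  tw_act iota (E 'X) (coef_col e n) = if n is n'.+1 then coef_col e n' else 0.

Lemma pairing_act e p x : is_tower e ->
  pairing (motive_act E p x) e = poly_tate iota p * pairing x e.
Proof.
move=> te; rewrite /poly_tate; elim/poly_ind: p => [|p c IHp].
  by rewrite motive_act0l pairing0 !rmorph0 mul0r.
rewrite motive_actDl motive_act_mulX motive_actC pairingD pairing_const.
rewrite rmorphD rmorphM /= map_polyX map_polyC rmorphD rmorphM mulrDl; congr (_ + _).
rewrite mulrAC -IHp mulrC; move: (motive_act _ _ _) => y.
apply: tateP => n; rewrite tateval_Xmul tateval_pairing tw_actM te.
by case: n => [|n]; rewrite ?tateval_pairing // tw_act0 mxE.
Qed.

Lemma pairing_comb r (m : 'I_r -> 'rV[twpoly K]_d) (c : 'rV[{poly K}]_r) e : is_tower e ->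
  pairing (motive_comb E m c) e =
    (map_mx (poly_tate iota) c *m \col_i pairing (m i) e) 0 0.
Proof.
move=> te; rewrite pairing_sum mxE; apply: eq_bigr => i _.
by rewrite pairing_act // !mxE.
Qed.

(** * Duality between towers and solutions of tau(u) = Theta u *)

Section Solutions.
Variables (r : nat) (m : 'I_r -> 'rV[twpoly K]_d).
Hypothesis hm : motive_basis E m.
Variable Theta : 'M[{poly K}]_r.
Hypothesis hTheta : forall i, motive_tau (m i) = \sum_j motive_act E (Theta i j) (m j).
Local Notation Phi := (motive_comb E m).
Local Notation ThetaT := (map_mx (poly_tate iota) Theta).
Local Notation tau := (tate_tau Fq).

Lemma tower_tau e : is_tower e ->
  map_mx tau (\col_i pairing (m i) e) = ThetaT *m \col_i pairing (m i) e.
Proof.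
move=> te; apply/colP => i; rewrite !mxE -pairing_tau [_ *: _]hTheta.
rewrite pairing_sum; apply: eq_bigr => j _.
by rewrite pairing_act // !mxE.
Qed.

(** The coordinate functions of E lie in the motive, so their values at a tower are
    K[t]-combinations of the values of the basis. *)
Lemma tower_eq e e' : is_tower e -> is_tower e' ->
  (forall i, pairing (m i) e = pairing (m i) e') -> e = e'.
Proof.
move=> te te' ee'; apply/colP => l; rewrite -!pairing_delta.
have [c ->] := motive_comb_surj hm (delta_mx 0 l).
rewrite !pairing_comb //; congr ((_ *m _) 0 0).
by apply/colP => i; rewrite !mxE.
Qed.

Lemma poly_tate_frob (p : {poly K}) :
  poly_tate iota (frob_poly p) = tau (poly_tate iota p).
Proof.
apply: tateP => n; rewrite tateval_tau /= (coef_map iota) coef_frob_poly coef_map.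
exact: rmorphXn.
Qed.

(** The solution u extends to a K[t]-linear map [Psi] from the motive to the Tate algebra. The
    equation makes it commute with tau, hence K{tau}-linear, and a K{tau}-linear map on row vectors
    is the pairing with its values on the coordinate functions. Linearity over t then says that
    these values form a tower. *)
Lemma solution_tower (u : 'cV[tate C]_r) : map_mx tau u = ThetaT *m u ->
  exists2 e, is_tower e & forall i, pairing (m i) e = u i 0.
Proof.
move=> tu; have [co coE] := boolp.choice (motive_comb_surj hm).
pose Psi y := (map_mx (poly_tate iota) (co y) *m u) 0 0.
have PsiE c : Psi (Phi c) = (map_mx (poly_tate iota) c *m u) 0 0.
  by rewrite /Psi; congr ((map_mx _ _ *m _) 0 0); apply: (motive_comb_inj hm); rewrite -coE.
have PsiD y z : Psi (y + z) = Psi y + Psi z.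
  by rewrite (coE y) (coE z) -motive_combD !PsiE map_mxD mulmxDl mxE.
have Psi0 : Psi 0 = 0 by rewrite -(motive_comb0 E m) PsiE map_mx0 mul0mx mxE.
have Psi_act p y : Psi (motive_act E p y) = poly_tate iota p * Psi y.
  by rewrite (coE y) -motive_combZ !PsiE map_mxZ -scalemxAl mxE.
have Psi_tau y : Psi (twtau K *: y) = tau (Psi y).
  rewrite (coE y) (motive_tau_comb hTheta) !PsiE map_mxM -mulmxA -tu.
  transitivity ((map_mx (tate_frob sC) (map_mx (poly_tate iota) (co y) *m u)) 0 0).
    rewrite map_mxM; congr ((_ *m _) 0 0).
    apply/rowP => i; rewrite !mxE; exact: poly_tate_frob.
  by rewrite mxE.
have Psi_tw f y : Psi (f *: y) = tate_twev f (Psi y).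
  rewrite {1}(twpoly_sum (leqnn (twsize f))) scaler_suml.
  rewrite (big_morph Psi PsiD Psi0); apply: eq_bigr => i _.
  rewrite -scalerA -(motive_actC E) Psi_act /poly_tate map_polyC; congr (_ * _).
  elim: (nat_of_ord i) => [|k IHk]; first by rewrite scale1r.
  by rewrite exprS -scalerA Psi_tau IHk iterS.
pose e : 'cV[tate C]_d := \col_l Psi (delta_mx 0 l).
have PsiP y : Psi y = pairing y e.
  rewrite {1}(row_sum_delta y) (big_morph Psi PsiD Psi0).
  by apply: eq_bigr => l _; rewrite Psi_tw mxE.
exists e => [n|i]; last first.
  have -> : m i = Phi (delta_mx 0 i).
    rewrite /motive_comb (bigD1 i) //= mxE !eqxx motive_actC rmorph1 scale1r.
    by rewrite big1 ?addr0 // => j ji; rewrite mxE (negPf ji) motive_act0l.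
  by rewrite -PsiP PsiE map_delta_mx -rowE mxE.
apply/colP => l.
have -> : tw_act iota (E 'X) (coef_col e n) l 0 =
    tateval (pairing (delta_mx 0 l *m E 'X) e) n.
  by rewrite tateval_pairing -rowE !mxE; apply: eq_bigr => k _; rewrite !mxE.
rewrite -PsiP -motive_actX Psi_act /poly_tate map_polyX tateval_Xmul.
by case: n => [|n]; rewrite !mxE.
Qed.

End Solutions.
End TatePoints.
End Evaluation.

(** * The exponential *)

Section Bounds.
Variables (R : realType) (C : ultraFieldType R).

Lemma vabs_sum_le I (s : seq I) (F : I -> C) (B : R) :
  0 <= B -> (forall i, vabs (F i) <= B) -> vabs (\sum_(i <- s) F i) <= B.
Proof.
move=> B0 FB; elim/big_rec: _ => [|i x _ xB]; first by rewrite vabs0.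
by rewrite (le_trans (vabsD _ _)) // ge_max FB.
Qed.

Definition vle n (z : 'cV[C]_n) (rho : R) := forall i, vabs (z i 0) <= rho.

Lemma vleD n (z w : 'cV[C]_n) rho : vle z rho -> vle w rho -> vle (z + w) rho.
Proof. by move=> zr wr i; rewrite mxE (le_trans (vabsD _ _)) // ge_max zr wr. Qed.

Lemma vleN n (z : 'cV[C]_n) rho : vle z rho -> vle (- z) rho.
Proof. by move=> zr i; rewrite mxE vabsN. Qed.

Lemma vle_trans n (z : 'cV[C]_n) rho sigma : rho <= sigma -> vle z rho -> vle z sigma.
Proof. by move=> rs zr i; rewrite (le_trans (zr i)). Qed.

Lemma vle0 n (z : 'cV[C]_n) : vle z 0 -> z = 0.
Proof.
by move=> z0; apply/colP => i; rewrite mxE; apply/eqP; rewrite -vabs_eq0 eq_le z0 vabs_ge0.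
Qed.

Lemma vle_ex n (z : 'cV[C]_n) : exists2 B : R, 0 < B & vle z B.
Proof.
exists (1 + \sum_i vabs (z i 0)).
  by rewrite ltr_pwDl ?ltr01 // sumr_ge0 // => i _; rewrite vabs_ge0.
move=> i; rewrite (bigD1 i) //= addrCA lerDl addr_ge0 ?ler01 // sumr_ge0 // => j _.
exact: vabs_ge0.
Qed.

Lemma mx_vabs_ex m n (A : 'M[C]_(m, n)) :
  exists2 B : R, 0 < B & forall i j, vabs (A i j) <= B.
Proof.
have [B B0 AB] := vle_ex (mxvec A)^T; exists B => // i j.
by have := AB (mxvec_index i j); rewrite mxE mxvecE.
Qed.

Lemma vle_mulmx m n (A : 'M[C]_(m, n)) (B : R) (z : 'cV_n) rho : 0 <= B -> 0 <= rho ->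
  (forall i j, vabs (A i j) <= B) -> vle z rho -> vle (A *m z) (B * rho).
Proof.
move=> B0 r0 AB zr i; rewrite mxE vabs_sum_le ?mulr_ge0 // => j.
by rewrite vabsM ler_pM ?vabs_ge0.
Qed.

(* For unipotent W, the powers W^n = \sum_a binom(n, a) (W - 1)^a are bounded. *)
Lemma unipotent_bounded n (T : 'M[C]_n) k : T ^+ k = 0 ->
  exists2 B : R, 0 < B & forall j a b, vabs (((T + 1%:M) ^+ j) a b) <= B.
Proof.
move=> Tk.
have TB i : exists u : R, 0 < u /\ forall a b, vabs ((T ^+ i) a b) <= u.
  by have [B B0 AB] := mx_vabs_ex (T ^+ i); exists B.
have [u uB] := boolp.choice TB.
have s0 : 0 <= \sum_(i < k) u i by rewrite sumr_ge0 // => i _; rewrite ltW ?(uB i).1.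
exists (1 + \sum_(i < k) u i); first by rewrite ltr_pwDl.
move=> j a b; rewrite exprD1n summxE vabs_sum_le ?addr_ge0 ?ler01 // => i.
have [ki|ik] := leqP k i.
  by rewrite -(subnK ki) exprD Tk mulr0 mul0rn mxE vabs0 addr_ge0 ?ler01.
have -> : (T ^+ i *+ 'C(j, i)) a b = (T ^+ i) a b * 'C(j, i)%:R.
  by rewrite mulr_natr; elim: 'C(j, i) => [|c IHc]; rewrite ?mxE // !mulrS mxE IHc.
rewrite vabsM (le_trans (ler_wpM2l (vabs_ge0 _) (vabs_natr_le1 _ _))) // mulr1.
rewrite (le_trans ((uB i).2 a b)) // (bigD1 (Ordinal ik)) //= addrCA lerDl.
by rewrite addr_ge0 ?ler01 // sumr_ge0 // => l _; rewrite ltW ?(uB l).1.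
Qed.

Lemma vnull_le_near (u v : nat -> C) (B : R) N :
  (forall n, (N <= n)%N -> vabs (u n) <= B * vabs (v n)) -> vnull v -> vnull u.
Proof.
move=> uv v0; have : vnull (fun n => u (n + N)%N).
  by apply: (@vnull_le _ _ _ B) (vnull_shift N v0) => n; rewrite uv ?leq_addl.
move=> /vnullP uN; apply/vnullP => e /uN[M uM]; exists (M + N)%N => n MNn.
by rewrite -(subnK (leq_trans (leq_addl M N) MNn)) uM //; lia.
Qed.

Lemma half_pow_small (rho e : R) : 0 < e -> exists k, rho / 2 ^+ k < e.
Proof.
move=> e0; exists (Num.bound (`|rho| / e)).
have re : 0 <= `|rho| / e by rewrite divr_ge0 ?normr_ge0 // ltW.
rewrite ltr_pdivrMr ?exprn_gt0 // mulrC -ltr_pdivrMr //.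
apply: le_lt_trans (_ : `|rho| / e < _); first by rewrite ler_pM2r ?invr_gt0 ?ler_norm.
apply: lt_le_trans (archi_boundP re) _.
by rewrite -natrX ler_nat ltnW // ltn_expl.
Qed.

End Bounds.

Section Exponential.
Variables (Fq : finFieldType) (K : fieldExtType {fraction {poly Fq}}).
Variables (R : realType) (C : ultraFieldType R) (iota : {rmorphism K -> C}).
Hypothesis hC : is_Cinf iota.
Variables (d : nat) (E : tmodule K d) (expE : 'cV[C]_d -> 'cV[C]_d).
Hypothesis hexp : is_exponential iota E expE.
Local Notation q := #|Fq|.
Local Notation sC := (scalarC iota).
Local Notation th := (iota (theta K)).
Local Notation N := (map_mx iota (twdiff (E 'X))).
Implicit Types z w y : 'cV[C]_d.

Lemma expED z w : expE (z + w) = expE z + expE w.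
Proof.
have [[Q [_ Qe]] _] := hexp; apply/colP => i; rewrite mxE.
apply: vcvg_unique (Qe (z + w) i) _.
apply: eq_vcvg (vcvgD (Qe z i) (Qe w i)) => n.
rewrite !summxE -big_split; apply: eq_bigr => k _ /=.
have -> : map_mx (fun x => x ^+ (q ^ k)) (z + w) =
    map_mx (fun x => x ^+ (q ^ k)) z + map_mx (fun x => x ^+ (q ^ k)) w.
  by apply/colP => j; rewrite !mxE (frobD sC).
by rewrite mulmxDr [RHS]mxE.
Qed.

Lemma expE0 : expE 0 = 0.
Proof. by apply: (addrI (expE 0)); rewrite -expED !addr0. Qed.

Lemma expEN z : expE (- z) = - expE z.
Proof. by apply: (addrI (expE z)); rewrite -expED !subrr expE0. Qed.

Lemma expE_functional z : expE (N *m z) = tw_act iota (E 'X) (expE z).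
Proof. exact: hexp.2. Qed.

Lemma vabs_theta_gt1 : 1 < vabs th.
Proof. by have [-> _ _ _] := hC; rewrite ltr1n finNzRing_gt1. Qed.

Lemma theta_neq0 : th != 0.
Proof. by rewrite -vabs_eq0 gt_eqF // (lt_trans ltr01 vabs_theta_gt1). Qed.

(* The error is quadratic because q >= 2. *)
Lemma expE_tangent : exists2 M : R, 0 < M & forall (rho : R) z,
  0 <= rho -> rho <= 1 -> vle z rho -> vle (expE z - z) (M * rho ^+ 2).
Proof.
have [[Q [Q0 Qe]] _] := hexp.
have Qb (ij : 'I_d * 'I_d) : exists M : R, 0 < M /\ forall n, vabs (Q n ij.1 ij.2) <= M.
  case: ij => i j /=.
  (* Unit vectors are fixed by Frobenius, so convergence of exp there forces the entries of Q_n to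
     tend to 0, hence to be bounded. *)
  pose dj : 'cV[C]_d := delta_mx j 0.
  pose u n := (\sum_(k < n) Q k *m map_mx (fun x => x ^+ (q ^ k)) dj) i 0.
  have /vcvgP ue : vcvg u (expE dj i 0) by exact: Qe.
  have uE n : u n.+1 - u n = Q n i j.
    rewrite /u /dj big_ord_recr mxE addrAC subrr add0r /= mxE (bigD1 j) //= !mxE !eqxx.
    rewrite expr1n mulr1 big1 ?addr0 // => k kj.
    by rewrite !mxE (negPf kj) (frob0 Fq) mulr0.
  have : vnull (fun n => Q n i j).
    apply/vnullP => e /ue[n0 un0]; exists n0 => n n0n.
    rewrite -uE; set x := expE _ _ _ in un0.
    rewrite (_ : _ - _ = (u n.+1 - x) - (u n - x)); last by rewrite opprB addrA subrK.
    by rewrite (le_lt_trans (vabsD _ _)) // gt_max vabsN !un0 // leqW.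
  by case/vnull_bounded => M M0 QM; exists M.
have [f fM] := boolp.choice Qb.
have f0 : 0 <= \sum_ij f ij by rewrite sumr_ge0 // => ij _; rewrite ltW ?(fM ij).1.
exists (1 + \sum_ij f ij); first by rewrite ltr_pwDl.
move=> rho z r0 r1 zr i; set M := 1 + _.
have M0 : 0 <= M by rewrite addr_ge0 ?ler01.
have QM n k j : vabs (Q n k j) <= M.
  rewrite (le_trans ((fM (k, j)).2 n)) // /M (bigD1 (k, j)) //= addrCA lerDl.
  by rewrite addr_ge0 ?ler01 // sumr_ge0 // => ij _; rewrite ltW ?(fM ij).1.
have B0 : 0 <= M * rho ^+ 2 by rewrite mulr_ge0 ?exprn_ge0.
pose u n := (\sum_(k < n) Q k *m map_mx (fun x => x ^+ (q ^ k)) z) i 0.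
have uz n : vabs (u n.+1 - z i 0) <= M * rho ^+ 2.
  rewrite /u big_ord_recl /= Q0 mul1mx !mxE expr1 addrAC subrr add0r summxE.
  apply: vabs_sum_le => // k; apply: vle_mulmx => //; first exact: exprn_ge0.
  move=> j.
  rewrite mxE vabsX (le_trans (lerXn2r _ _ _ (zr j))) ?nnegrE ?vabs_ge0 //.
  rewrite ler_wiXn2l // (leq_trans (finNzRing_gt1 Fq)) //.
  by rewrite -{1}[q]expn1 leq_exp2l ?finNzRing_gt1.
have uc : vcvg (fun n => u n.+1 - z i 0) ((expE z - z) i 0).
  rewrite !mxE; apply: (@vcvgD _ _ (fun n => u n.+1) (fun=> - z i 0)).
    by apply: eq_vnull (vnull_shift 1 (Qe z i)) => n; rewrite addn1.
  exact: vcvg_cst.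
exact: vcvg_vabs_le uc.
Qed.

Lemma expE_local : exists (delta M : R), [/\ 0 < delta, delta <= 1, 0 < M,
  forall (rho : R) z, 0 <= rho -> rho <= delta -> vle z rho ->
    vle (expE z - z) (M * rho ^+ 2) &
  forall (rho : R) z, 0 <= rho -> rho <= delta -> vle z rho -> vle (expE z - z) (rho / 2)].
Proof.
have [M M0 MP] := expE_tangent.
(* For rho <= 1 / (2 M) the quadratic error M rho^2 is at most rho / 2. *)
exists (Num.min 1 (M^-1 / 2)), M.
have dm : 0 < Num.min 1 (M^-1 / 2) by rewrite lt_min ltr01 divr_gt0 ?invr_gt0.
split=> // [|rho z r0|rho z r0]; first by rewrite ge_min lexx.
  by rewrite le_min => /andP[r1 _]; exact: MP.
rewrite le_min => /andP[r1 rM] zr; apply: vle_trans (MP _ _ r0 r1 zr).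
rewrite expr2 mulrA mulrC ler_wpM2l // (le_trans (ler_wpM2l (ltW M0) rM)) //.
by rewrite mulrA mulfV ?mul1r // gt_eqF.
Qed.

(** * Local inversion of the exponential *)

Section Local.
Variable delta : R.
Hypothesis delta0 : 0 < delta.
Hypothesis expE_half : forall (rho : R) z,
  0 <= rho -> rho <= delta -> vle z rho -> vle (expE z - z) (rho / 2).

Lemma expE_small (rho : R) z : 0 <= rho -> rho <= delta -> vle z rho -> vle (expE z) rho.
Proof.
move=> r0 rd zr; rewrite -(subrK z (expE z)); apply: vleD => //.
apply: vle_trans (expE_half r0 rd zr); rewrite ler_pdivrMr //.
by rewrite mulr_natr mulr2n lerDl.
Qed.

(** A zero of exp is, up to sign, its own error term, so any bound on it can be halved
    indefinitely. *)
Lemma expE_local_inj z : vle z delta -> expE z = 0 -> z = 0.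
Proof.
move=> zd ez; apply: vle0 => i; apply/ler_addgt0Pr => e e0; rewrite add0r.
have [k /ltW ke] := half_pow_small delta e0; apply: le_trans ke.
suff : vle z (delta / 2 ^+ k) by apply.
elim: {e e0 i} k => [|k IHk]; first by rewrite expr0 divr1.
have := expE_half _ _ IHk; rewrite ez sub0r exprSr invfM mulrA => H i.
rewrite -vabsN; have := H _ _ i; rewrite mxE; apply.
  by rewrite divr_ge0 ?exprn_ge0 // ltW.
by rewrite ler_pdivrMr ?exprn_gt0 // ler_peMr ?(ltW delta0) // exprn_ege1 ?ler1n.
Qed.

(** Fixed-point iteration of z -> y - (exp z - z), which contracts by 1/2; completeness of C
    provides the limit. *)
Lemma expE_local_surj (rho : R) y : 0 <= rho -> rho <= delta -> vle y rho ->
  exists2 z, vle z rho & expE z = y.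
Proof.
move=> r0 rd yr; have [zz zz0 zzS] : exists2 zz : nat -> 'cV[C]_d, zz 0%N = 0 &
    forall k, zz k.+1 = y - (expE (zz k) - zz k).
  by exists (fun k => iter k (fun z => y - (expE z - z)) 0).
have rk0 k : 0 <= rho / 2 ^+ k by rewrite divr_ge0 ?exprn_ge0.
have rkd k : rho / 2 ^+ k <= rho.
  by rewrite ler_pdivrMr ?exprn_gt0 // ler_peMr // exprn_ege1 ?ler1n.
have zd k : vle (zz k.+1 - zz k) (rho / 2 ^+ k).
  elim: k => [|k IHk].
    by rewrite zzS zz0 expE0 !subr0 expr0 divr1.
  (* By additivity of exp, each increment is minus the error term of the preceding one. *)
  have -> : zz k.+2 - zz k.+1 = - (expE (zz k.+1 - zz k) - (zz k.+1 - zz k)).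
    rewrite expED expEN [zz k.+2]zzS {3}[zz k.+1]zzS.
    move: (expE (zz k)) (expE (zz k.+1)) (zz k.+1) (zz k) => a b c e.
    by apply/colP => i; rewrite !mxE; ring.
  by apply: vleN; rewrite exprSr invfM mulrA; apply: expE_half => //; apply: le_trans rd.
have zr k : vle (zz k) rho.
  elim: k => [|k IHk]; first by move=> i; rewrite zz0 mxE vabs0.
  by rewrite -(subrK (zz k) (zz k.+1)); apply: vleD => //; apply: vle_trans (zd k).
have zmn k l : vle (zz (l + k)%N - zz k) (rho / 2 ^+ k).
  elim: l => [|l IHl]; first by move=> i; rewrite subrr mxE vabs0.
  rewrite addSn -(subrK (zz (l + k)%N) (zz (l + k).+1)) -addrA; apply: vleD => //.
  apply: vle_trans (zd _); rewrite ler_wpM2l // lef_pV2 ?posrE ?exprn_gt0 //.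
  by rewrite ler_weXn2l ?ler1n // leq_addl.
have [_ cC _ _] := hC.
have lim (i : 'I_d) : exists x, vcvg (fun k => zz k i 0) x.
  apply: cC => e e0; have [k ke] := half_pow_small rho e0.
  exists k => a b ka kb.
  rewrite -(subnK ka) -(subnK kb); set u := zz (a - k + k)%N; set v := zz (b - k + k)%N.
  rewrite (_ : u i 0 - v i 0 = (u - zz k) i 0 - (v - zz k) i 0); last first.
    by rewrite !mxE opprB addrA subrK.
  rewrite (le_lt_trans (vabsD _ _)) // vabsN gt_max.
  by rewrite !(le_lt_trans (zmn _ _ _) ke).
have [f fP] := boolp.choice lim; pose z : 'cV_d := \col_i f i.
have zk k : vle (z - zz k) (rho / 2 ^+ k).
  move=> i; rewrite !mxE.
  have : vcvg (fun l => zz (l + k)%N i 0 - zz k i 0) (f i - zz k i 0).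
    apply: (@vcvgD _ _ (fun l => zz (l + k)%N i 0) (fun=> - zz k i 0)); last exact: vcvg_cst.
    exact: (vnull_shift k (fP i)).
  by apply: vcvg_vabs_le => // l; have := zmn k l i; rewrite !mxE.
exists z; first by have := zk 0%N; rewrite zz0 subr0 expr0 divr1.
apply/eqP; rewrite -subr_eq0; apply/eqP/vle0 => i; apply/ler_addgt0Pr => e e0.
have [k /ltW ke] := half_pow_small rho e0; rewrite add0r; apply: le_trans ke.
suff : vle (expE z - y) (rho / 2 ^+ k) by apply.
clear i; have -> : expE z - y = expE (z - zz k) - (zz k.+1 - zz k).
  rewrite expED expEN zzS; move: (expE z) (expE (zz k)) (zz k) => a b c.
  by apply/colP => i; rewrite !mxE; ring.
apply: vleD; last exact/vleN/zd.
by apply: expE_small => //; apply: le_trans rd.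
Qed.

End Local.
End Exponential.

(** * Periods and Anderson generating functions *)

Section Periods.
Variables (Fq : finFieldType) (K : fieldExtType {fraction {poly Fq}}).
Variables (R : realType) (C : ultraFieldType R) (iota : {rmorphism K -> C}).
Hypothesis hC : is_Cinf iota.
Variables (d : nat) (E : tmodule K d) (expE : 'cV[C]_d -> 'cV[C]_d).
Hypothesis hexp : is_exponential iota E expE.
Local Notation q := #|Fq|.
Local Notation th := (iota (theta K)).
Local Notation N := (map_mx iota (twdiff (E 'X))).
Local Notation SK := (twdiff (E 'X) - (theta K)%:M).
Local Notation S := (N - th%:M).
Implicit Types z w y lambda : 'cV[C]_d.

Lemma tm_nilp_exp : SK ^+ d = 0.
Proof. by have [n /nilpotent_mx_exp] := tm_phi_nilp E. Qed.

Lemma map_nilp_exp k : map_mx iota (SK ^+ k) = S ^+ k.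
Proof.
elim: k => [|k IHk]; first by rewrite !expr0 map_mx1.
by rewrite !exprS map_mxM IHk map_mxB map_scalar_mx.
Qed.

Lemma lie_nilp_exp : S ^+ d = 0.
Proof. by rewrite -map_nilp_exp tm_nilp_exp map_mx0. Qed.

Lemma lie_unit : N \in unitmx.
Proof.
have cx : GRing.comm (th%:M : 'M[C]_d) (- S).
  by rewrite /GRing.comm [LHS]mul_scalar_mx [RHS]mul_mx_scalar.
(* Factor theta^d - (- S)^d, where theta - (- S) = N and S^d = 0: N divides the invertible scalar
   theta^d. *)
have := subrXX_comm d cx; rewrite opprK addrCA subrr addr0 exprNn lie_nilp_exp mulr0 subr0.
set X := \sum_(i < d) _ => NX.
have thd k : (th%:M : 'M[C]_d) ^+ k = (th ^+ k)%:M.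
  by elim: k => [|k IHk] //; rewrite exprS IHk (exprS th) scalar_mxM.
have NX1 : N *m (th ^- d *: X) = 1%:M.
  rewrite -scalemxAr -[N *m X]NX thd scale_scalar_mx mulVf //.
  by rewrite expf_neq0 // (theta_neq0 hC).
by have [] := mulmx1_unit NX1.
Qed.

(** The matrix theta N^-1 is unipotent, so its powers are bounded and N^-n is O(|theta|^-n). *)
Lemma lie_inv_bound : exists2 B : R, 0 < B & forall n z (rho : R), 0 <= rho ->
  vle z rho -> vle (invmx N ^+ n *m z) (B * vabs (th^-1 ^+ n) * rho).
Proof.
pose W := th *: invmx N; pose T := - (invmx N * S).
have TW : T + 1%:M = W.
  rewrite /T mulrBr [_ * N]mulVmx ?lie_unit // opprB subrK.
  by rewrite [_ * _%:M]mul_mx_scalar.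
have cNS : GRing.comm (invmx N) S.
  rewrite /GRing.comm mulrBr mulrBl [_ * N]mulVmx ?lie_unit // [N * _]mulmxV ?lie_unit //.
  by rewrite [_ * _%:M]mul_mx_scalar [_%:M * _]mul_scalar_mx.
have Td : T ^+ d = 0.
  by rewrite /T exprNn exprMn_comm // lie_nilp_exp !mulr0.
have [B B0 TB] := unipotent_bounded Td; exists B => // n z rho r0 zr.
have -> : invmx N ^+ n = th^-1 ^+ n *: (T + 1%:M) ^+ n.
  have -> : invmx N = th^-1 *: W by rewrite scalerA mulVf ?scale1r ?(theta_neq0 hC).
  rewrite TW; elim: n => [|n IHn]; first by rewrite !expr0 scale1r.
  by rewrite !exprS IHn -[_ * _]scalemxAl -scalemxAr scalerA.
rewrite -scalemxAl => i; rewrite mxE vabsM -mulrA mulrCA ler_wpM2l ?vabs_ge0 //.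
by apply: vle_mulmx => //; exact: ltW.
Qed.

(** The coefficient of t^n in (N - t)^-1 lambda, whence the shifted exponent. *)
Definition lie_div lambda n := invmx N ^+ n.+1 *m lambda.

Lemma lie_div0 lambda : N *m lie_div lambda 0 = lambda.
Proof. by rewrite /lie_div expr1 mulKVmx ?lie_unit. Qed.

Lemma lie_divS lambda n : N *m lie_div lambda n.+1 = lie_div lambda n.
Proof.
by rewrite /lie_div [_ ^+ n.+2]exprS -mulmxA mulKVmx ?lie_unit.
Qed.

Lemma lie_div_bound lambda : exists2 B : R, 0 < B & forall n,
  vle (lie_div lambda n) (B * vabs (th^-1 ^+ n)).
Proof.
have [B B0 NB] := lie_inv_bound; have [M M0 lM] := vle_ex lambda.
exists (B * vabs th^-1 * M).
  by rewrite !mulr_gt0 // lt_neqAle eq_sym vabs_eq0 invr_eq0 (theta_neq0 hC) vabs_ge0.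
move=> n; apply: vle_trans (NB n.+1 _ _ (ltW M0) lM).
by rewrite exprS vabsM; lra.
Qed.

Lemma thetaV_null : vnull (fun n => th^-1 ^+ n).
Proof.
apply: vnull_exp; have := vabsM th th^-1; rewrite mulfV ?(theta_neq0 hC) // vabs1 => e.
have t1 := vabs_theta_gt1 hC.
by rewrite -(ltr_pM2l (lt_trans ltr01 t1)) -e mulr1.
Qed.

Lemma lie_div_small (delta B : R) : 0 < delta -> 0 < B ->
  exists n0, forall n, (n0 <= n)%N -> B * vabs (th^-1 ^+ n) <= delta.
Proof.
move=> d0 B0; have /vnullP/(_ _ (divr_gt0 d0 B0))[n0 n0P] := thetaV_null.
by exists n0 => n /n0P; rewrite ltr_pdivlMr // mulrC => /ltW.
Qed.

(* The Anderson generating function of a period. *)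
Lemma tower_of_period lambda : expE lambda = 0 ->
  exists2 e, is_tower iota E e & forall n, coef_col e n = expE (lie_div lambda n).
Proof.
move=> el0; have [B B0 lB] := lie_div_bound lambda.
have [delta [M [d0 d1 M0 _ half]]] := expE_local hexp.
have [n0 n0P] := lie_div_small d0 B0.
have tP (l : 'I_d) : (fun n => expE (lie_div lambda n) l 0) \in @tate_pred R C.
  rewrite unfold_in; apply/asboolP; apply: (@vnull_le_near _ _ _ _ B n0) thetaV_null => n nn0.
  by apply: (expE_small half); rewrite ?mulr_ge0 ?vabs_ge0 ?(ltW B0) ?n0P.
exists (\col_l Tate (tP l)); last by move=> n; apply/colP => l; rewrite !mxE.
have eE n : coef_col (\col_l Tate (tP l)) n = expE (lie_div lambda n).
  by apply/colP => l; rewrite !mxE.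
move=> n; rewrite eE -(expE_functional hexp).
by case: n => [|n]; rewrite ?lie_div0 ?lie_divS ?eE.
Qed.

Lemma lie_iter k z : invmx N ^+ k *m (N ^+ k *m z) = z.
Proof.
elim: k => [|k IHk]; first by rewrite !expr0 !mul1mx.
rewrite exprSr exprS -[(_ * _) *m z]mulmxA -[(_ * _) *m _]mulmxA.
by rewrite [invmx N *m _]mulKmx ?lie_unit.
Qed.

Lemma expE_tower e k n : is_tower iota E e -> forall z, expE z = coef_col e (k + n)%N ->
  expE (N ^+ k *m z) = coef_col e n.
Proof.
move=> te; elim: k => [|k IHk] z ez; first by rewrite expr0 mul1mx.
rewrite exprSr -[(_ * _) *m z]mulmxA; apply: IHk.
by rewrite (expE_functional hexp) ez te.
Qed.

(** The coefficients of e tend to 0, so from some rank on they have small logarithms. Local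
    injectivity makes these compatible under N, and multiplying one of them by a power of N yields
    lambda. *)
Lemma period_of_tower e : is_tower iota E e ->
  exists2 lambda, expE lambda = 0 & forall n, coef_col e n = expE (lie_div lambda n).
Proof.
move=> te; have [delta [M [d0 d1 M0 _ half]]] := expE_local hexp.
have [B B0 NB] := mx_vabs_ex N.
(* With entries of N bounded by B, multiplication by N maps the ball of radius [delta'] into that of
   radius [delta], where exp is injective. *)
pose delta' := Num.min delta (delta / B).
have d'0 : 0 < delta' by rewrite lt_min d0 divr_gt0.
have d'd : delta' <= delta by rewrite ge_min lexx.
have en l : exists n0, forall n, (n0 <= n)%N -> vabs (tateval (e l 0) n) < delta'.
  by have /asboolP/vnullP := tatevalP (e l 0); apply.
have [f fP] := boolp.choice en; pose n0 := \max_l f l.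
have esmall n : (n0 <= n)%N -> vle (coef_col e n) delta'.
  move=> n0n l; rewrite mxE ltW // fP // (leq_trans _ n0n) //.
  exact: (leq_bigmax l).
have surj n : (n0 <= n)%N -> exists2 z, vle z delta' & expE z = coef_col e n.
  by move=> n0n; apply: (expE_local_surj hC hexp half) => //; [exact: ltW | exact: esmall].
have [z zd' ez] := surj n0 (leqnn _).
have up k : vle (invmx N ^+ k *m z) delta /\ expE (invmx N ^+ k *m z) = coef_col e (k + n0)%N.
  elim: k => [|k [IHd IHe]]; first by rewrite expr0 mul1mx; split=> //; apply: vle_trans zd'.
  have [z' zd'' ez'] := surj (k.+1 + n0)%N (leq_addl _ _).
  have Nz' : N *m z' = invmx N ^+ k *m z.
    apply/eqP; rewrite -subr_eq0; apply/eqP; apply: (expE_local_inj d0 half).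
      apply: vleD; last exact: vleN.
      have := vle_mulmx (ltW B0) (ltW d'0) NB zd''; apply: vle_trans.
      by rewrite mulrC -ler_pdivlMr // ge_min lexx orbT.
    rewrite (expED hexp) (expEN hexp) (expE_functional hexp) ez' te IHe.
    by rewrite addSn subrr.
  have -> : invmx N ^+ k.+1 *m z = z'.
    by rewrite exprS -[(_ * _) *m z]mulmxA -Nz' mulKmx ?lie_unit.
  by split=> //; apply: vle_trans zd''.
exists (N ^+ n0.+1 *m z).
  rewrite exprS -[(_ * _) *m z]mulmxA (expE_functional hexp).
  by rewrite (expE_tower (n := 0) te) ?te // addn0.
(* From n0 on the logarithms constructed in [up] apply; below n0 one descends from n0 by applying
   phi_t. *)
move=> n; rewrite /lie_div; have [n0n|nn0] := leqP n0 n.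
  rewrite -{1 2}(subnK n0n) -(up (n - n0)%N).2 -addnS exprD.
  by rewrite -[(_ * _) *m (_ *m z)]mulmxA lie_iter.
have -> : N ^+ n0.+1 = N ^+ n.+1 *m N ^+ (n0 - n).
  by rewrite [RHS](_ : _ = N ^+ n.+1 * N ^+ (n0 - n)) // -exprD addSn subnKC // ltnW.
rewrite -mulmxA lie_iter; apply/esym/(expE_tower te).
by rewrite ez subnK // ltnW.
Qed.

Lemma tw_tangent (x : 'rV[twpoly K]_d) : exists2 B : R, 0 < B & forall (rho : R) z,
  0 <= rho -> rho <= 1 -> vle z rho ->
  vabs (tw_act iota x z 0 0 - (map_mx iota (twdiff x) *m z) 0 0) <= B * rho ^+ 2.
Proof.
have fB l : exists B : R, 0 < B /\ forall i, vabs (iota (twcoef (x 0 l) i)) <= B.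
  have [B B0 PB] := mx_vabs_ex (\row_(i < twsize (x 0 l)) iota (twcoef (x 0 l) i)).
  exists B; split=> // i; have [ix|xi] := ltnP i (twsize (x 0 l)).
    by have := PB 0 (Ordinal ix); rewrite mxE.
  by rewrite [twcoef _ _]nth_default // rmorph0 vabs0 ltW.
have [f fP] := boolp.choice fB; exists (1 + \sum_l f l).
  by rewrite ltr_pwDl ?ltr01 // sumr_ge0 // => l _; rewrite ltW ?(fP l).1.
move=> rho z r0 r1 zr; rewrite !mxE -sumrB.
have fS l : f l <= 1 + \sum_l f l.
  rewrite (bigD1 l) //= addrCA lerDl addr_ge0 ?ler01 // sumr_ge0 // => k _.
  by rewrite ltW ?(fP k).1.
have B0 : 0 <= (1 + \sum_l f l) * rho ^+ 2.
  rewrite mulr_ge0 ?exprn_ge0 // addr_ge0 ?ler01 // sumr_ge0 // => l _.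
  by rewrite ltW ?(fP l).1.
apply: vabs_sum_le => // l.
rewrite (tw_evalE iota (z l 0) (leqnSn _)) big_ord_recl !mxE expr1 addrAC subrr add0r.
apply: vabs_sum_le => // i; rewrite vabsM ler_pM ?vabs_ge0 //.
  by rewrite (le_trans ((fP l).2 _)).
rewrite vabsX (le_trans (lerXn2r _ _ _ (zr l))) ?nnegrE ?vabs_ge0 //.
rewrite ler_wiXn2l // (leq_trans (finNzRing_gt1 Fq)) //.
by rewrite -{1}[q]expn1 leq_exp2l ?finNzRing_gt1.
Qed.

(* The coefficients are O(|theta|^(-2n)) because exp and the action of [x] are tangent
   to their linear parts to second order. *)
Lemma decays_tw_tangent (x : 'rV[twpoly K]_d) lambda : decays th (fun n =>
  tw_act iota x (expE (lie_div lambda n)) 0 0 -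
    (map_mx iota (twdiff x) *m lie_div lambda n) 0 0).
Proof.
have [B B0 lB] := lie_div_bound lambda.
have [delta [M [d0 d1 M0 tang half]]] := expE_local hexp.
have [A A0 xA] := tw_tangent x; have [D D0 xD] := mx_vabs_ex (map_mx iota (twdiff x)).
have [n0 n0P] := lie_div_small d0 B0.
apply: (@vnull_le_near _ _ _ _ ((A + D * M) * B ^+ 2) n0) thetaV_null => n nn0.
set z := lie_div lambda n; set rho := B * vabs (th^-1 ^+ n).
have r0 : 0 <= rho by rewrite mulr_ge0 ?vabs_ge0 // ltW.
have zr : vle z rho by exact: lB.
have rd : rho <= delta by exact: n0P.
have r1 := le_trans rd d1.
have r20 : 0 <= rho ^+ 2 by rewrite exprn_ge0.
set w := _ - _.
have wE : w =
    (tw_act iota x (expE z) 0 0 - (map_mx iota (twdiff x) *m expE z) 0 0)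
    + (map_mx iota (twdiff x) *m (expE z - z)) 0 0.
  rewrite mulmxBr /w; move: (_ *m _) (_ *m _) => a b; rewrite !mxE.
  by rewrite addrA subrK.
have wB : vabs w <= (A + D * M) * rho ^+ 2.
  rewrite wE (le_trans (vabsD _ _)) // ge_max; apply/andP; split.
    apply: le_trans (xA _ _ r0 r1 (expE_small half r0 rd zr)) _.
    by rewrite ler_wpM2r // lerDl mulr_ge0 ?(ltW D0) ?(ltW M0).
  have := vle_mulmx (ltW D0) (mulr_ge0 (ltW M0) r20) xD (tang _ _ r0 rd zr) => /(_ 0).
  by move/le_trans; apply; rewrite mulrA ler_wpM2r // lerDr ltW.
rewrite vabsM (le_trans (ler_wpM2r (vabs_ge0 _) wB)) //.
rewrite /rho exprMn mulrA -[X in X <= _]mulrA ler_wpM2l //.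
  by rewrite mulr_ge0 ?exprn_ge0 ?addr_ge0 ?mulr_ge0 ?(ltW A0) ?(ltW D0) ?(ltW M0) ?(ltW B0).
rewrite expr2 -!vabsM -mulrA [X in _ * X](_ : _ = 1) ?mulr1 //.
by rewrite -exprMn mulVf ?(theta_neq0 hC) // expr1n.
Qed.

(** Coefficientwise form of (t - theta) (N - t)^-1 = S (N - t)^-1 - 1, which follows from t - theta
    = S - (N - t). *)
Lemma mul_Xsub_lie_div (u : 'rV[C]_d) lambda n :
  mul_Xsub th (fun k => (u *m lie_div lambda k) 0 0) n =
  (u *m S *m lie_div lambda n) 0 0 - cst_fps ((u *m lambda) 0 0) n.
Proof.
rewrite -mulmxA mulmxBl mul_scalar_mx mulmxBr -scalemxAr /mul_Xsub.
case: n => [|n] /=.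
  by rewrite lie_div0; move: (u *m lambda) (u *m _) => a b; rewrite !mxE; ring.
by rewrite lie_divS; move: (u *m _) (u *m lie_div lambda n) => a b; rewrite !mxE; ring.
Qed.

(** Here [v 0] is the polar part u (N - t)^-1 lambda and [w] the tangency error, analytic at theta.
    As u S^k = 0 the pole has order at most k, and order s selects the coefficient of (t -
    theta)^-(k - s). *)
Lemma period_hyper_value lambda e (x : 'rV[twpoly K]_d) k s :
    (forall n, coef_col e n = expE (lie_div lambda n)) ->
    twdiff x *m SK ^+ k = 0 -> (s < k)%N ->
  tate_value (hyperderiv s (tate_poly (('X - th%:P) ^+ k) * pairing iota x e)) th
    (- (map_mx iota (twdiff x *m SK ^+ (k - s.+1)) *m lambda) 0 0).
Proof.
move=> eE xk sk; set u := map_mx iota (twdiff x).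
pose v a n := (u *m S ^+ a *m lie_div lambda n) 0 0.
pose c a := (u *m S ^+ a *m lambda) 0 0.
pose w n := tw_act iota x (expE (lie_div lambda n)) 0 0 - (u *m lie_div lambda n) 0 0.
have vS a n : mul_Xsub th (v a) n = v a.+1 n - cst_fps (c a) n.
  by rewrite mul_Xsub_lie_div /v exprSr -[u *m _ *m S]mulmxA.
have vk n : v k n = 0.
  by rewrite /v -map_nilp_exp -map_mxM xk map_mx0 mul0mx mxE.
have := hyper_value_polar (theta_neq0 hC) vS vk (decays_tw_tangent x lambda) sk.
rewrite map_mxM map_nilp_exp -/u -/(c _).
rewrite /tate_value /hyper_value => H; apply: eq_vcvg H => n; apply: eq_bigr => i _.
rewrite hyperderivE tateval_iter_mul_Xsub; congr (_ *+ _ * _); congr (iter _ _ _ _).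
by apply/funext => j; rewrite tateval_pairing eE /v expr0 mulmx1 addrC subrK.
Qed.

End Periods.

(** * Diagonal bases of the motive *)

Section MotiveDiagonal.
Variables (Fq : finFieldType) (K : fieldExtType {fraction {poly Fq}}).
Variables (d : nat) (E : tmodule K d).
Local Notation SK := (twdiff (E 'X) - (theta K)%:M).
Local Notation T := ('X - (theta K)%:P).
Variables (r : nat) (m : 'I_r -> 'rV[twpoly K]_d).
Hypothesis hm : motive_basis E m.
Variable Theta : 'M[{poly K}]_r.
Hypothesis hTheta : forall i, motive_tau (m i) = \sum_j motive_act E (Theta i j) (m j).
Local Notation Phi := (motive_comb E m).

(** Since (t - theta)^d annihilates the differentials, (t - theta)^d times a row of P lies in the
    row span of Theta = A D P. Cancelling P shows that each diagonal entry of D divides (t -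
    theta)^d. *)
Lemma motive_diagonalization : exists (A P : 'M[{poly K}]_r) (k : 'I_r -> nat),
  [/\ A \in unitmx, P \in unitmx, forall i, (k i <= d)%N &
      Theta = A *m diag_mx (\row_i T ^+ k i) *m P].
Proof.
have [A [D [P [uA uP ThE]]]] := poly_diagonalization Theta.
have Dk i : exists ku : nat * K,
    [/\ (ku.1 <= d)%N, ku.2 != 0 & D 0 i = ku.2 *: T ^+ ku.1].
  have : twdiff (Phi (T ^+ d *: row i P)) = 0.
    by rewrite motive_combZ twdiff_act_Xsub tm_nilp_exp mulmx0.
  case/(twdiff_comb_eq0 hm hTheta) => b; rewrite ThE mulmxA => /(congr1 (mulmx^~ (invmx P))).
  rewrite mulmxK // -scalemxAl -row_mul mulmxV // mulmxA => /rowP/(_ i).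
  rewrite mul_mx_diag !mxE eqxx mulr1 => TdE.
  have /dvdp_exp_XsubCP[k kd /eqpP[[u v] /= /andP[u0 v0] uvE]] : D 0 i %| T ^+ d.
    by rewrite TdE dvdp_mull.
  exists (k, u^-1 * v); split=> //=; first by rewrite mulf_neq0 ?invr_eq0.
  by rewrite -scalerA -uvE scalerA mulVf ?scale1r.
have [ku kuP] := boolp.choice Dk.
(* The constant factors of the diagonal entries are absorbed into A. *)
exists (A *m diag_mx (\row_i (ku i).2%:P)), P, (fun i => (ku i).1); split=> //.
- rewrite unitmx_mul uA unitmxE det_diag rpred_prod // => i _.
  by rewrite mxE poly_unitE size_polyC coefC eqxx unitfE; case: (kuP i) => _ -> _.
- by move=> i; case: (kuP i).
rewrite ThE; congr (_ *m _); rewrite -mulmxA; congr (_ *m _).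
apply/matrixP => i j; rewrite mul_diag_mx !mxE.
case: eqP => [->|_]; last by rewrite !mulr0n mulr0.
by rewrite !mulr1n mul_polyC; case: (kuP j).
Qed.

Section Coordinates.
Variables (A P : 'M[{poly K}]_r) (k : 'I_r -> nat).
Hypotheses (uA : A \in unitmx) (uP : P \in unitmx).
Hypothesis ThE : Theta = A *m diag_mx (\row_i T ^+ k i) *m P.
Local Notation mu i := (twdiff (Phi (row i P))).

(** Row i of A^-1 Theta is (t - theta)^(k_i) times row i of P, and combinations of rows of Theta
    have zero differential. *)
Lemma twdiff_diag_eq0 i : mu i *m SK ^+ k i = 0.
Proof.
rewrite -twdiff_act_Xsub -motive_combZ.
have -> : T ^+ k i *: row i P = row i (invmx A) *m Theta.
  rewrite -row_mul ThE !mulmxA mulVmx // mul1mx.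
  by apply/rowP => j; rewrite mxE mul_diag_mx !mxE.
exact: (twdiff_comb_theta hTheta).
Qed.

(** The row space of [G] is stable under N and contains the differentials of the basis given by P,
    hence those of the whole motive, including the coordinate functions. So d rows of [G] form an
    invertible matrix. *)
Lemma lie_coordinates : exists u : 'M[K]_d, u \in unitmx /\
  forall l, exists i (j : nat), (j < k i)%N /\ row l u = mu i *m SK ^+ j.
Proof.
pose n := #|{: 'I_r * 'I_d}|.
pose G : 'M[K]_(n, d) := \matrix_(a < n) (mu (enum_val a).1 *m SK ^+ (enum_val a).2).
have rowG a : row a G = mu (enum_val a).1 *m SK ^+ (enum_val a).2 by rewrite rowK.
have muG i j : (mu i *m SK ^+ j <= G)%MS.
  have [dj|jd] := leqP d j.
    by rewrite -(subnK dj) exprD tm_nilp_exp mulr0 mulmx0 sub0mx.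
  have := row_sub (enum_rank (i, Ordinal jd)) G; by rewrite rowG enum_rankK.
have GS : (G *m SK <= G)%MS.
  by apply/row_subP => a; rewrite row_mul rowG -mulmxA -[SK ^+ _ *m SK]exprSr muG.
have GN : (G *m twdiff (E 'X) <= G)%MS.
  rewrite -[twdiff (E 'X)](subrK (theta K)%:M) mulmxDr addmx_sub //.
  by rewrite mul_mx_scalar scalemx_sub.
have actG p x : (twdiff x <= G)%MS -> (twdiff (motive_act E p x) <= G)%MS.
  move=> xG; elim/poly_ind: p => [|p c IHp].
    by rewrite motive_act0l twdiffE map_mx0 sub0mx.
  rewrite motive_actDl motive_act_mulX motive_actC twdiffD twdiffM twdiff_scalel.
  by rewrite addmx_sub ?scalemx_sub // (submx_trans (submxMr _ IHp)).
have fullG : row_full G.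
  rewrite -sub1mx; apply/row_subP => l.
  have -> : row l 1%:M = twdiff (map_mx (@twconst _ K) (row l 1%:M)).
    by rewrite twdiff_map_const.
  have [c ->] := motive_comb_surj hm (map_mx (@twconst _ K) (row l 1%:M)).
  rewrite -(mulmxKV uP c) motive_comb_mul twdiff_sum summx_sub // => i _.
  by apply: actG; have := muG i 0%N; rewrite expr0 mulmx1.
have [f uf] := unitmx_rowsub fullG; exists (rowsub f G); split=> // l.
have rE : row l (rowsub f G) = mu (enum_val (f l)).1 *m SK ^+ (enum_val (f l)).2.
  by rewrite -rowG; apply/rowP => j; rewrite !mxE.
exists (enum_val (f l)).1, (enum_val (f l)).2; split=> //.
(* An exponent j >= k_i would give a zero row in an invertible matrix. *)
rewrite ltnNge; apply/negP => kj.
have : row l (rowsub f G) = 0.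
  by rewrite rE -(subnKC kj) exprD mulmxA twdiff_diag_eq0 mul0mx.
move/(congr1 (mulmx^~ (invmx (rowsub f G)))); rewrite -row_mul mulmxV // mul0mx.
by move/rowP/(_ l)/eqP; rewrite !mxE eqxx oner_eq0.
Qed.

End Coordinates.

Lemma twconst_scalar_comm (f : twpoly K) (a : Fq) :
  f * twconst (@scalarK _ K a) = twconst (@scalarK _ K a) * f.
Proof.
have aq n : scalarK K a ^+ (#|Fq| ^ n) = scalarK K a.
  elim: n => [|n IHn]; first by rewrite expr1.
  by rewrite expnSr exprM IHn -rmorphXn expf_card.
apply: twpolyP => n; rewrite twcoef_mulC twcoef_mul big_ord_recr /= subnn twcoefC aq.
rewrite big1 ?add0r 1?mulrC // => i _.
by rewrite twcoefC subn_eq0 leqNgt ltn_ord (frob0 Fq) mulr0.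
Qed.

Lemma motive_act_scalar (p : {poly Fq}) x :
  motive_act E (map_poly (@scalarK _ K) p) x = x *m E p.
Proof.
elim/poly_ind: p => [|p c IHp]; first by rewrite !rmorph0 motive_act0l mulmx0.
rewrite !rmorphD !rmorphM /= map_polyX map_polyC motive_actDl motive_act_mulX IHp.
rewrite motive_actC mulmxDr mulmxA tm_phi_const; congr (_ + _).
apply/rowP => l; rewrite !mxE (bigD1 l) //= mxE eqxx mulr1n.
rewrite big1 ?addr0 => [|j jl]; last by rewrite mxE (negPf jl) mulr0.
by rewrite [RHS]twconst_scalar_comm.
Qed.

End MotiveDiagonal.

(** * The period lattice *)

Section PeriodModule.
Variables (Fq : finFieldType) (K : fieldExtType {fraction {poly Fq}}).
Variables (R : realType) (C : ultraFieldType R) (iota : {rmorphism K -> C}).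
Hypothesis hC : is_Cinf iota.
Variables (d : nat) (E : tmodule K d) (expE : 'cV[C]_d -> 'cV[C]_d).
Hypothesis hexp : is_exponential iota E expE.
Variables (r : nat) (m : 'I_r -> 'rV[twpoly K]_d).
Hypothesis hm : motive_basis E m.
Variable Theta : 'M[{poly K}]_r.
Hypothesis hTheta : forall i, motive_tau (m i) = \sum_j motive_act E (Theta i j) (m j).
Local Notation ThetaT := (map_mx (poly_tate iota) Theta).
Local Notation tau := (tate_tau Fq).
Local Notation sC := (scalarC iota).
Local Notation N := (map_mx iota (twdiff (E 'X))).
Local Notation ldiv := (lie_div iota E).

Lemma poly_tate_Xsub c k :
  poly_tate iota (('X - c%:P) ^+ k) = tate_poly (('X - (iota c)%:P) ^+ k).
Proof. by rewrite /poly_tate rmorphXn rmorphB /= map_polyX map_polyC. Qed.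

Lemma theta_tate_unit : ThetaT \in unitmx.
Proof.
have [A [P [k [uA uP _ ->]]]] := motive_diagonalization hm hTheta.
rewrite !map_mxM !unitmx_mul (unitmx_map _ uA) (unitmx_map _ uP) andbT /=.
rewrite unitmxE map_diag_mx det_diag rpred_prod // => i _.
rewrite !mxE [X in X \in _](poly_tate_Xsub _ _) rmorphXn rpredX //.
exact/tate_unit_Xsub/vabs_theta_gt1.
Qed.

Variable Upsilon : 'M[tate C]_r.
Hypothesis uU : Upsilon \in unitmx.
Hypothesis hU : map_mx tau Upsilon = Upsilon *m invmx ThetaT.

Lemma tau_mulmx n p q (M : 'M[tate C]_(n, p)) (M' : 'M_(p, q)) :
  map_mx tau (M *m M') = map_mx tau M *m map_mx tau M'.
Proof. exact: (map_mxM (tate_frob sC)). Qed.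

Lemma tau_Upsilon_unit : map_mx tau Upsilon \in unitmx.
Proof. by rewrite hU unitmx_mul uU unitmx_inv theta_tate_unit. Qed.

Definition scalar_tate (a : {poly Fq}) : tate C := tate_poly (map_poly sC a).

Lemma tau_scalar_tate a : tau (scalar_tate a) = scalar_tate a.
Proof.
apply: tateP => n; rewrite tateval_tau /= coef_map -[LHS](rmorphXn sC).
by rewrite expf_card.
Qed.

Lemma scalar_tate_inj : injective scalar_tate.
Proof.
move=> a b ab; apply/polyP => n; apply: (fmorph_inj sC).
by have := congr1 (fun f => tateval f n) ab; rewrite /= !coef_map.
Qed.

Fact scalar_tate_zmod_morphism : zmod_morphism scalar_tate.
Proof. by move=> a b; rewrite /scalar_tate !rmorphB. Qed.
HB.instance Definition _ :=
  GRing.isZmodMorphism.Build {poly Fq} (tate C) scalar_tate scalar_tate_zmod_morphism.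

Fact scalar_tate_monoid_morphism : monoid_morphism scalar_tate.
Proof. by split=> [|a b]; rewrite /scalar_tate ?rmorph1 ?rmorphM. Qed.
HB.instance Definition _ :=
  GRing.isMonoidMorphism.Build {poly Fq} (tate C) scalar_tate scalar_tate_monoid_morphism.

Lemma lie_divD z w n : ldiv (z + w) n = ldiv z n + ldiv w n.
Proof. exact: mulmxDr. Qed.

(** For large n the vector N^(-n-1) (z - w) is a zero of exp small enough for local injectivity. *)
Lemma lie_div_inj z w : (forall n, expE (ldiv z n) = expE (ldiv w n)) -> z = w.
Proof.
move=> zw; apply/eqP; rewrite -subr_eq0; apply/eqP.
have [B B0 lB] := lie_div_bound hC E (z - w).
have [delta [M [d0 d1 M0 _ half]]] := expE_local hexp.
have [n nP] := lie_div_small hC d0 B0.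
have : ldiv (z - w) n = 0.
  apply: (expE_local_inj d0 half); first exact: vle_trans (nP n _) (lB n).
  rewrite lie_divD (expED hexp) zw -(expED hexp) -lie_divD subrr.
  by rewrite /lie_div mulmx0 (expE0 hexp).
rewrite /lie_div => H; have uN := lie_unit hC E.
have uNn : invmx N ^+ n.+1 \in unitmx.
  by elim: n.+1 => [|k IHk]; rewrite ?unitmx1 // exprS unitmx_mul unitmx_inv uN.
by rewrite -(mulKmx uNn (z - w)) H mulmx0.
Qed.

(* The Anderson generating function [e] of the period [lambda] is a solution of
   tau u = Theta u, that is [- Upsilon u] has coordinates [a] in F_q[t]. *)
Definition period_coord (lambda : 'cV[C]_d) (a : 'cV[{poly Fq}]_r) :=
  exists e, [/\ is_tower iota E e, forall n, coef_col e n = expE (ldiv lambda n) &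
    Upsilon *m (\col_i pairing iota (m i) e) = - map_mx scalar_tate a].

Lemma period_coord_ex lambda : expE lambda = 0 -> exists a, period_coord lambda a.
Proof.
move=> l0; have [e te eE] := tower_of_period hC hexp l0.
set u := \col_i pairing iota (m i) e.
have fixed : map_mx tau (Upsilon *m u) = Upsilon *m u.
  by rewrite tau_mulmx (tower_tau hTheta te) hU -mulmxA mulKmx ?theta_tate_unit.
have aP i : exists a, (Upsilon *m u) i 0 = - scalar_tate a.
  have /(tate_tau_fixed sC)[a aE] : tau ((Upsilon *m u) i 0) = (Upsilon *m u) i 0.
    by have /colP/(_ i) := fixed; rewrite [LHS]mxE.
  by exists (- a); rewrite rmorphN opprK.
have [f fP] := boolp.choice aP; exists (\col_i f i), e; split=> //.
by apply/colP => i; rewrite fP !mxE.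
Qed.

Lemma period_coord_surj a : exists2 lambda, expE lambda = 0 & period_coord lambda a.
Proof.
pose u := - (invmx Upsilon *m map_mx scalar_tate a).
have tu : map_mx tau u = ThetaT *m u.
  have Uu : Upsilon *m u = - map_mx scalar_tate a by rewrite mulmxN mulKVmx.
  have : map_mx tau (Upsilon *m u) = Upsilon *m u.
    rewrite Uu; apply/colP => i; rewrite !mxE -rmorphN; exact: tau_scalar_tate.
  rewrite tau_mulmx hU -mulmxA => /(congr1 (mulmx (invmx Upsilon))).
  rewrite !mulKmx // => /(congr1 (mulmx ThetaT)).
  by rewrite mulKVmx ?theta_tate_unit.
have [e te eu] := solution_tower hm hTheta tu.
have [lambda l0 eE] := period_of_tower hC hexp te.
exists lambda => //; exists e; split=> //.
have -> : \col_i pairing iota (m i) e = u by apply/colP => i; rewrite mxE eu.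
by rewrite mulmxN mulKVmx.
Qed.

Lemma period_coord_inj lambda lambda' a :
  period_coord lambda a -> period_coord lambda' a -> lambda = lambda'.
Proof.
move=> [e [te eE ea]] [e' [te' eE' ea']]; apply: lie_div_inj => n.
rewrite -eE -eE'; congr coef_col; apply: (tower_eq hm te te') => i.
have : Upsilon *m (\col_i pairing iota (m i) e) = Upsilon *m (\col_i pairing iota (m i) e').
  by rewrite ea ea'.
by move/(congr1 (mulmx (invmx Upsilon))); rewrite !mulKmx // => /colP/(_ i); rewrite !mxE.
Qed.

Lemma coef_col_inj e e' : (forall n, coef_col e n = coef_col e' n :> 'cV[C]_d) -> e = e'.
Proof.
by move=> ee; apply/colP => l; apply: tateP => n; have /colP/(_ l) := ee n; rewrite !mxE.
Qed.

Lemma period_coord_fun lambda a a' : period_coord lambda a -> period_coord lambda a' -> a = a'.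
Proof.
move=> [e [te eE ea]] [e' [te' eE' ea']].
have ee : e = e' by apply: coef_col_inj => n; rewrite eE eE'.
apply/colP => i; apply: scalar_tate_inj; apply: oppr_inj.
have : - map_mx scalar_tate a = - map_mx scalar_tate a' by rewrite -ea -ea' ee.
by move=> /colP/(_ i); rewrite !mxE.
Qed.

Lemma period_coordD lambda lambda' a a' : expE lambda = 0 -> expE lambda' = 0 ->
  period_coord lambda a -> period_coord lambda' a' ->
  period_coord (lambda + lambda') (a + a').
Proof.
move=> l0 l0' [e [te eE ea]] [e' [te' eE' ea']].
have l0'' : expE (lambda + lambda') = 0 by rewrite (expED hexp) l0 l0' addr0.
have [e'' te'' eE''] := tower_of_period hC hexp l0''.
exists e''; split=> //.
have -> : \col_i pairing iota (m i) e'' =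
    \col_i pairing iota (m i) e + \col_i pairing iota (m i) e'.
  apply/colP => i; rewrite !mxE; apply: tateP => n.
  by rewrite tatevalD !tateval_pairing eE eE' eE'' lie_divD (expED hexp) tw_actD mxE.
by rewrite mulmxDr ea ea' map_mxD opprD.
Qed.

Lemma lie_act_period p lambda : expE lambda = 0 -> expE (lie_act iota E p lambda) = 0.
Proof. by move=> l0; rewrite hexp.2 l0 tw_act0. Qed.

(** As d phi_p commutes with N^-1, the generating function of d phi_p lambda is phi_p(e); composing
    the basis with phi_p is multiplication by p in the motive. *)
Lemma period_coordZ p lambda a : expE lambda = 0 ->
  period_coord lambda a -> period_coord (lie_act iota E p lambda) (p *: a).
Proof.
move=> l0 [e [te eE ea]].
have [e' te' eE'] := tower_of_period hC hexp (lie_act_period p l0).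
exists e'; split=> //.
have comm : GRing.comm (map_mx iota (twdiff (E p))) N.
  rewrite /GRing.comm -[LHS]map_mxM -[RHS]map_mxM -!twdiffM.
  by rewrite -[E p *m _]rmorphM -[E 'X *m _]rmorphM mulrC.
have actE n : ldiv (lie_act iota E p lambda) n = lie_act iota E p (ldiv lambda n).
  rewrite /lie_div /lie_act !mulmxA; congr (_ *m _).
  have uN := lie_unit hC E.
  have commV : GRing.comm (map_mx iota (twdiff (E p))) (invmx N).
    rewrite /GRing.comm -[LHS](mulKmx uN) [N *m (_ * _)]mulmxA -[N *m _]comm.
    by rewrite -[(_ * _) *m _]mulmxA mulmxV // mulmx1.
  exact/esym/(commrX n.+1 commV).
have -> : \col_i pairing iota (m i) e' = scalar_tate p *: \col_i pairing iota (m i) e.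
  apply/colP => i; rewrite !mxE.
  have -> : scalar_tate p = poly_tate iota (map_poly (@scalarK _ K) p).
    by rewrite /scalar_tate /poly_tate -map_poly_comp.
  rewrite -(pairing_act _ _ te) motive_act_scalar; apply: tateP => n.
  by rewrite !tateval_pairing eE' actE hexp.2 tw_actM eE.
by rewrite -scalemxAr ea map_mxZ scalerN.
Qed.

Lemma period_basis : exists lambda : 'I_r -> 'cV[C]_d,
  module_basis (lie_act iota E) (period_lattice expE) lambda /\
  forall j, expE (lambda j) = 0 /\ period_coord (lambda j) (delta_mx j 0).
Proof.
have lP j : exists l, expE l = 0 /\ period_coord l (delta_mx j 0).
  by have [l l0 lj] := period_coord_surj (delta_mx j 0); exists l.
have [lambda lambdaP] := boolp.choice lP; exists lambda; split=> //.
(* If a is a coordinate vector of 0, so is a + a, and uniqueness gives a = 0. *)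
have coord0 : period_coord 0 0.
  have [a aP] := period_coord_ex (expE0 hexp).
  have := period_coordD (expE0 hexp) (expE0 hexp) aP aP; rewrite addr0 => aP'.
  have a0 : a = 0 by apply: (addrI a); rewrite addr0; exact: period_coord_fun aP' aP.
  by rewrite a0 in aP.
have coord_sum (c : 'rV[{poly Fq}]_r) :
    period_coord (\sum_i lie_act iota E (c 0 i) (lambda i)) c^T.
  suff [_] : expE (\sum_i lie_act iota E (c 0 i) (lambda i)) = 0 /\
      period_coord (\sum_i lie_act iota E (c 0 i) (lambda i)) (\sum_i c 0 i *: delta_mx i 0).
    by congr period_coord; rewrite {2}[c]row_sum_delta raddf_sum; apply: eq_bigr => i _;
      rewrite /= linearZ /= trmx_delta.
  elim/big_ind2: _ => [|l a l' a' [l0 la] [l0' la']|i _].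
  - by rewrite (expE0 hexp).
  - by rewrite (expED hexp) l0 l0' addr0; split=> //; apply: period_coordD.
  - have [l0 la] := lambdaP i; split; first exact: lie_act_period.
    exact: period_coordZ.
split=> [j|x x0]; first by have [] := lambdaP j.
have [a xa] := period_coord_ex x0; exists a^T; split.
  by apply: period_coord_inj xa _; rewrite -{2}[a]trmxK.
by move=> c xc; rewrite xc in xa; rewrite (period_coord_fun xa (coord_sum c)) trmxK.
Qed.

End PeriodModule.

(** * Periods as values of hyperderivatives at theta *)

Theorem theorem5p2 (Fq : finFieldType) (K : fieldExtType {fraction {poly Fq}})
    (R : realType) (C : ultraFieldType R) (iota : {rmorphism K -> C})
    (hC : is_Cinf iota)
    (d : nat) (E : tmodule K d) (expE : 'cV[C]_d -> 'cV[C]_d)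
    (hexp : is_exponential iota E expE)
    (hunif : uniformizable expE) (habel : abelian_tmodule E)
    (r : nat) (m : 'I_r -> 'rV[twpoly K]_d) (hm : motive_basis E m)
    (Theta : 'M[{poly K}]_r)
    (hTheta : forall i, motive_tau (m i) = \sum_j motive_act E (Theta i j) (m j))
    (Upsilon : 'M[tate C]_r) (hUnit : Upsilon \in unitmx)
    (hUpsilon : map_mx (tate_tau Fq) Upsilon =
                Upsilon *m invmx (map_mx (poly_tate iota) Theta)) :
  exists (B : 'M[{poly K}]_r) (U : 'M[twpoly K]_d),
    [/\ B \in unitmx, coordinate_system U &
      let RR := map_mx (tate_tau Fq) Upsilon *m
                map_mx (poly_tate iota) (invmx B) in
      [/\ RR \in unitmx,
          rho d.-1 RR \in unitmx,
          rho d.-1 (invmx RR) = invmx (rho d.-1 RR) &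
          exists (s : nat) (lambda : 'I_s -> 'cV[C]_d),
            module_basis (lie_act iota E) (period_lattice expE) lambda /\
            forall (j : 'I_s) (i : 'I_d), exists a b,
              tate_value (rho d.-1 (invmx RR) a b) (iota (theta K))
                ((map_mx iota (twdiff U) *m lambda j) i 0)]].
Proof.
(* Used with n = d: the number of blocks is [d.-1.+1], which equals d because b < k_i <= d forces d
   > 0. *)
have sub_lt a b n : (b < a -> a <= n -> a - b.+1 < n.-1.+1)%N by lia.
have subS_lt a b : (b < a -> a - b.+1 < a)%N by lia.
have subSK a b : (b < a -> a - (a - b.+1).+1 = b)%N by lia.
have [A [P [k [uA uP kd ThE]]]] := motive_diagonalization hm hTheta.
have [u [uu uP']] := lie_coordinates hm hTheta uA uP ThE.
have [lambda [lbasis lP]] := period_basis hC hexp hm hTheta hUnit hUpsilon.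
pose AT := map_mx (poly_tate iota) A.
have uAT : AT \in unitmx by exact: unitmx_map.
have utau := tau_Upsilon_unit hC hm hTheta hUnit hUpsilon.
have uB : invmx A \in unitmx by rewrite unitmx_inv.
exists (invmx A), (map_mx (@twconst _ K) u); split.
- exact: uB.
- exact: coordinate_system_const.
rewrite invmxK -/AT; set RR := _ *m AT => /=.
have uRR : RR \in unitmx by exact: (unitmx_mulP utau uAT).
have [urho rhoV] := rho_unit d.-1 uRR; split=> //.
exists r, lambda; split=> // j l; have [_ [e [te eE eU]]] := lP j.
have [i [b [bk ulE]]] := uP' l.
set x := \col_i pairing iota (m i) e in eU.
(* Apply tau to Upsilon x = - e_j, whose right side is fixed, and use tau(x) = Theta x. *)
have thetax : map_mx (poly_tate iota) Theta *m x =
    invmx (map_mx (tate_tau Fq) Upsilon) *m - delta_mx j 0.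
  rewrite -(tower_tau hTheta te) -/x -[LHS](mulKmx utau) -(tau_mulmx iota) eU map_delta_mx.
  by congr (_ *m _); rewrite [LHS](map_mxN (tate_frob (scalarC iota))) map_delta_mx.
pose DP := diag_mx (\row_i ('X - (theta K)%:P) ^+ k i) *m P.
have polyx : poly_tate iota (('X - (theta K)%:P) ^+ k i) *
    pairing iota (motive_comb E m (row i P)) e = - invmx RR i j.
  have : map_mx (poly_tate iota) DP *m x = invmx RR *m - delta_mx j 0.
    apply: (mulmx_solve uAT utau); rewrite -thetax ThE -[A *m _ *m _]mulmxA -/DP.
    by rewrite [map_mx _ (A *m _)]map_mxM.
  rewrite /DP map_mxM map_diag_mx -mulmxA mul_diag_mx mulmxN => /colP/(_ i).
  rewrite (pairing_comb _ _ te) -colE !mxE => <-; congr (_ * _).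
  by apply: eq_bigr => a _; rewrite !mxE.
have sd : (k i - b.+1 < d.-1.+1)%N := sub_lt _ _ _ bk (kd i).
(* In block row 0 the block column is the order of the hyperderivative; k_i - b - 1 is the order
   that extracts S^b. *)
exists (tagnat.Rank (0 : 'I_d.-1.+1) i), (tagnat.Rank (Ordinal sd) j).
have -> : rho d.-1 (invmx RR) (tagnat.Rank (0 : 'I_d.-1.+1) i) (tagnat.Rank (Ordinal sd) j)
    = hyperderiv (k i - b.+1) (invmx RR i j).
  have := mxblockK (fun a b : 'I_d.-1.+1 => if (a <= b)%N then
    map_mx (hyperderiv (b - a)) (invmx RR) else 0) 0 (Ordinal sd).
  by move/matrixP/(_ i j); rewrite !mxE /= subn0.
have sk : (k i - b.+1 < k i)%N := subS_lt _ _ bk.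
have := period_hyper_value hC hexp eE (twdiff_diag_eq0 hTheta uA ThE i) sk.
rewrite -poly_tate_Xsub polyx => H.
(* Two signs cancel: that of the polar expansion and that of [polyx]. *)
have -> : (map_mx iota (twdiff (map_mx (@twconst _ K) u)) *m lambda j) l 0 =
    -1 * - (map_mx iota (twdiff (motive_comb E m (row i P)) *m
      (twdiff (E 'X) - (theta K)%:M) ^+ (k i - (k i - b.+1).+1)) *m lambda j) 0 0.
  rewrite (subSK _ _ bk) -ulE mulrNN mul1r twdiff_map_const !mxE; apply: eq_bigr => a _.
  by rewrite !mxE.
apply: eq_vcvg (vcvgZ (-1) H) => n; rewrite mulr_sumr; apply: eq_bigr => a _.
by rewrite !hyperderivE tatevalN mulNrn mulNr mul1r mulNr opprK.
Qed.
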